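(* Let $n\in\mathbb{N}$, let $E\subset\mathbb{R}^n$ be closed and let $V$ be a Banach space. Let $\omega:(0,\infty)\to(0,\infty)$ be a non-decreasing function with $\lim_{t\to 0}\omega(t)=0$, $\lim_{t\to0}\frac{t}{\omega(t)}=0$ and $\lim_{t\to\infty}\omega(t)=\infty$, for which there is a constant $C_\omega>0$ such that $\frac{s}{\omega(s)}\le C_\omega\frac{t}{\omega(t)}$ whenever $0<s\le t<\infty$. Then there is a constant $C>0$, depending only on $n$ and $\omega$, such that the following hold. (1) If $f\in\dot{\mathrm{VC}}^{0,\omega}_{\mathrm{small}}(E,V)$ and $\varepsilon>0$, there exists $G\in\mathrm{Lip}(\mathbb{R}^n,V)\cap C^\infty(\mathbb{R}^n;V)\cap\dot{C}^{0,\omega}(\mathbb{R}^n,V)$ such that $$\|f-G|_E\|_{\dot{C}^{0,\omega}(E,V)}<\varepsilon,\qquad \|G\|_{\dot{C}^{0,\omega}(\mathbb{R}^n,V)}\le C\|f\|_{\dot{C}^{0,\omega}(E,V)}.$$ (2) If $f\in\dot{\mathrm{VC}}^{0,\omega}(E,V)$ and $\varepsilon>0$, there exists $G\in C_c^\infty(\mathbb{R}^n;V)\cap\dot{C}^{0,\omega}(\mathbb{R}^n,V)$ such that $$\|f-G|_E\|_{\dot{C}^{0,\omega}(E,V)}<\varepsilon,\qquad \|G\|_{\dot{C}^{0,\omega}(\mathbb{R}^n,V)}\le C\|f\|_{\dot{C}^{0,\omega}(E,V)}.$$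
   Context: For a set $E\subset\mathbb{R}^n$ (including $E=\mathbb{R}^n$) and a normed space $V$, $\dot{C}^{0,\omega}(E,V)$ is the space of functions $f:E\to V$ with finite seminorm $\|f\|_{\dot{C}^{0,\omega}(E,V)}:=\sup_{x\ne y\in E}\frac{\|f(x)-f(y)\|}{\omega(|x-y|)}$. Each of the following is the set of $f\in\dot{C}^{0,\omega}(E,V)$ such that (suprema over empty sets are $0$): - $\dot{\mathrm{VC}}^{0,\omega}_{\mathrm{small}}(E,V)$: $\lim_{\delta\to0}\sup_{x\neq y\in E,\ |x-y|\le\delta}\frac{\|f(x)-f(y)\|}{\omega(|x-y|)}=0$; - $\dot{\mathrm{VC}}^{0,\omega}_{\mathrm{large}}(E,V)$: $\lim_{\delta\to\infty}\sup_{x\neq y\in E,\ |x-y|\ge\delta}\frac{\|f(x)-f(y)\|}{\omega(|x-y|)}=0$; - $\dot{\mathrm{VC}}^{0,\omega}_{\mathrm{far}}(E,V)$: $\lim_{\delta\to\infty}\sup_{x\neq y\in E,\ \min(|x|,|y|)\ge\delta}\frac{\|f(x)-f(y)\|}{\omega(|x-y|)}=0$. $\dot{\mathrm{VC}}^{0,\omega}(E,V)$ is the intersection of these three. $\mathrm{Lip}(\mathbb{R}^n,V)$ denotes the Lipschitz functions $\mathbb{R}^n\to V$, and $C_c^\infty(\mathbb{R}^n;V)$ the smooth compactly supported functions $\mathbb{R}^n\to V$. *)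

(* Defs.v *)
From HB Require Import structures.
From mathcomp Require Import all_boot all_order all_algebra.
From mathcomp Require Import all_classical all_reals all_analysis.
Set Implicit Arguments.
Unset Strict Implicit.
Unset Printing Implicit Defensive.
Import Order.TTheory GRing.Theory Num.Theory.
Import numFieldNormedType.Exports.
Local Open Scope classical_set_scope.
Local Open Scope ring_scope.

(* The library norm `|x| on 'rV[R]_n is the sup norm, hence this definition;
   both norms induce the same topology and the same differentiable maps. *)
Definition enorm (R : realType) (n : nat) (x : 'rV[R]_n) : R :=
  Num.sqrt (\sum_(i < n) x ord0 i ^+ 2).

(* Functions E -> V are represented by total functions 'rV[R]_n -> V of which
   only the values on E are used; likewise only w t for 0 < t matters below. *)

(* The supremum of the w-difference quotients over pairs x != y in E with
   P x y. Adding 0 changes nothing except that the empty supremum is 0. *)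
Definition osc_sup (R : realType) (n : nat) (V : normedModType R) (w : R -> R)
    (E : set 'rV[R]_n) (P : 'rV[R]_n -> 'rV[R]_n -> Prop)
    (f : 'rV[R]_n -> V) : \bar R :=
  ereal_sup ([set 0%E] `|`
    [set q | exists x y, [/\ E x, E y, x <> y, P x y &
       q = (`|f x - f y| / w (enorm (x - y)))%:E]]).

Definition holder_seminorm (R : realType) (n : nat) (V : normedModType R)
    (w : R -> R) (E : set 'rV[R]_n) (f : 'rV[R]_n -> V) : \bar R :=
  osc_sup w E (fun _ _ => True) f.

Definition holder (R : realType) (n : nat) (V : normedModType R)
    (w : R -> R) (E : set 'rV[R]_n) (f : 'rV[R]_n -> V) : Prop :=
  (holder_seminorm w E f < +oo)%E.

Definition VC_small (R : realType) (n : nat) (V : normedModType R)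
    (w : R -> R) (E : set 'rV[R]_n) (f : 'rV[R]_n -> V) : Prop :=
  holder w E f /\
  osc_sup w E (fun x y => enorm (x - y) <= d) f @[d --> 0^'+] --> 0%E.

Definition VC_large (R : realType) (n : nat) (V : normedModType R)
    (w : R -> R) (E : set 'rV[R]_n) (f : 'rV[R]_n -> V) : Prop :=
  holder w E f /\
  osc_sup w E (fun x y => d <= enorm (x - y)) f @[d --> +oo] --> 0%E.

Definition VC_far (R : realType) (n : nat) (V : normedModType R)
    (w : R -> R) (E : set 'rV[R]_n) (f : 'rV[R]_n -> V) : Prop :=
  holder w E f /\
  osc_sup w E (fun x y => d <= Num.min (enorm x) (enorm y)) f @[d --> +oo]
    --> 0%E.

Definition VC (R : realType) (n : nat) (V : normedModType R)
    (w : R -> R) (E : set 'rV[R]_n) (f : 'rV[R]_n -> V) : Prop :=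
  [/\ VC_small w E f, VC_large w E f & VC_far w E f].

Definition Lip (R : realType) (n : nat) (V : normedModType R)
    (f : 'rV[R]_n -> V) : Prop :=
  exists L : R, forall x y, `|f x - f y| <= L * enorm (x - y).

(* Since the domain is finite-dimensional, the Frechet derivative of f is C^k
   iff all the directional derivatives of f are. *)
Fixpoint Ck (R : realType) (n : nat) (V : normedModType R) (k : nat)
    (f : 'rV[R]_n -> V) : Prop :=
  if k is k'.+1 then
    (forall x, differentiable f x) /\ (forall v, Ck k' (fun x => 'D_v f x))
  else continuous f.

Definition Cinfty (R : realType) (n : nat) (V : normedModType R)
    (f : 'rV[R]_n -> V) : Prop := forall k, Ck k f.

Definition Cc_infty (R : realType) (n : nat) (V : normedModType R)
    (f : 'rV[R]_n -> V) : Prop :=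
  Cinfty f /\ compact (closure [set x | f x <> 0]).

(* Main.v *)
(* Fix a scale d at which f oscillates by at most eps * w. Everything takes place
   on the lattice d Z^n. Choose for each lattice point k a nearly closest point
   p k of E, at distance d_k, and let F k be the average of the values f (p l)
   over the lattice points l in the cube centred at k whose radius is about
   d_k / 6. Two such cubes at distance s are both contained in a cube whose
   volume exceeds theirs by a factor 1 + O(s / d_k), so their averages differ by
   O(s / d_k) times the oscillation O(w d_k) of the averaged values; by the
   ratio condition this is O(w s). Hence interpolating F with a smooth partition
   of unity at scale d gives G with |G x - G y| <= C ||f|| w |x - y|. Near E the
   cubes reduce to single points, G only involves values of f at distance O(d),
   and w-closeness of G to f on E follows at distances below d from the Lipschitz
   bound on G, and above d from the sup bound on f - G.

   For compact support, multiply G - G x0 by a cutoff of large radius r. As w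
   tends to infinity, f - f x0 is at most eps * w r on E within distance 2r of 0,
   so that the error (1 - chi) (f - f x0) is small in the w-seminorm on E. *)

Require Import Defs.
From HB Require Import structures.
From mathcomp Require Import all_boot all_order all_algebra.
From mathcomp Require Import all_classical all_reals all_analysis.
From mathcomp Require Import ring lra zify.
Set Implicit Arguments.
Unset Strict Implicit.
Unset Printing Implicit Defensive.
Import Order.TTheory GRing.Theory Num.Theory.
Import numFieldNormedType.Exports.
Local Open Scope classical_set_scope.
Local Open Scope ring_scope.

(** * Calculus of C^k maps *)

Section CkCalculus.
Context {R : realType} {n : nat}.
Implicit Types (V : normedModType R) (u : 'rV[R]_n -> R) (k : nat).

Lemma CkS V k (f : 'rV[R]_n -> V) : Ck k.+1 f <->
  (forall x, differentiable f x) /\ (forall v, Ck k (fun x => 'D_v f x)).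
Proof. by []. Qed.

Lemma CkW V k (f : 'rV[R]_n -> V) : Ck k.+1 f -> Ck k f.
Proof.
elim: k f => [|k IH] f [df Df]; last by split=> // v; exact: IH.
by move=> x; exact/differentiable_continuous/df.
Qed.

Lemma Ck_cst V k (c : V) : Ck k (fun _ : 'rV[R]_n => c).
Proof.
elim: k c => [|k IH] c; first exact: cst_continuous.
split=> [x|v]; first exact: differentiable_cst.
suff -> : (fun x : 'rV[R]_n => 'D_v (fun=> c) x) = (fun=> 0) by exact: IH.
by apply/funext => x; exact: derive_cst.
Qed.

Lemma CkD V k (f g : 'rV[R]_n -> V) :
  Ck k f -> Ck k g -> Ck k (fun x => f x + g x).
Proof.
elim: k f g => [|k IH] f g.
  by move=> cf cg x; exact: (cvgD (cf x) (cg x)).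
move=> /CkS[df Df] /CkS[dg Dg]; apply/CkS; split=> [x|v].
  exact: (differentiableD (df x) (dg x)).
have -> : (fun x => 'D_v (fun x => f x + g x) x) =
    (fun x => 'D_v f x + 'D_v g x).
  by apply/funext => x; rewrite deriveD//; exact: diff_derivable.
exact: IH (Df v) (Dg v).
Qed.

Lemma CkZ V k (c : R) (f : 'rV[R]_n -> V) :
  Ck k f -> Ck k (fun x => c *: f x).
Proof.
elim: k f => [|k IH] f; first by move=> cf x; exact: (cvgZl_tmp (cf x)).
move=> /CkS[df Df]; apply/CkS; split=> [x|v].
  exact: (differentiableZ _ (df x)).
have -> : (fun x => 'D_v (fun x => c *: f x) x) = (fun x => c *: 'D_v f x).
  by apply/funext => x; rewrite deriveZ//; exact: diff_derivable.
exact: IH (Df v).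
Qed.

Lemma Ck_sum V k (I : Type) (s : seq I) (f : I -> 'rV[R]_n -> V) :
  (forall i, Ck k (f i)) -> Ck k (fun x => \sum_(i <- s) f i x).
Proof.
move=> Cf; elim: s => [|i s IH].
  by under eq_fun do rewrite big_nil; exact: Ck_cst.
by under eq_fun do rewrite big_cons; exact: CkD.
Qed.

Lemma Ck_scalel V k (u : 'rV[R]_n -> R) (c : V) :
  Ck k u -> Ck k (fun x => u x *: c).
Proof.
elim: k u => [|k IH] u.
  by move=> cu x; exact: (cvgZr_tmp (cu x)).
move=> /CkS[du Du]; apply/CkS; split=> [x|v];
  first exact: (differentiableZl _ (du x)).
have -> : (fun x => 'D_v (fun x => u x *: c) x) = (fun x => 'D_v u x *: c).
  apply/funext => x; rewrite !deriveE//; last exact: (differentiableZl _ (du x)).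
  by rewrite diffZl.
exact: IH (Du v).
Qed.

Lemma CkM k u1 u2 : Ck k u1 -> Ck k u2 ->
  Ck k (fun x => u1 x * u2 x).
Proof.
elim: k u1 u2 => [|k IH] f g.
  by move=> cf cg x; exact: (cvgM (cf x) (cg x)).
move=> /[dup] Cf /CkS[df Df] /[dup] Cg /CkS[dg Dg]; apply/CkS; split=> [x|v].
  exact: (differentiableM (df x) (dg x)).
have -> : (fun x => 'D_v (fun x => f x * g x) x) =
    (fun x => f x * 'D_v g x + g x * 'D_v f x).
  by apply/funext => x; rewrite deriveM//; exact: diff_derivable.
exact: (CkD (IH _ _ (CkW Cf) (Dg v)) (IH _ _ (CkW Cg) (Df v))).
Qed.

Lemma Ck_prod k (I : Type) (s : seq I) (f : I -> 'rV[R]_n -> R) :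
  (forall i, Ck k (f i)) -> Ck k (fun x => \prod_(i <- s) f i x).
Proof.
move=> Cf; elim: s => [|i s IH].
  by under eq_fun do rewrite big_nil; exact: Ck_cst.
by under eq_fun do rewrite big_cons; exact: CkM.
Qed.

Lemma CkV k u : (forall x, u x != 0) -> Ck k u ->
  Ck k (fun x => (u x)^-1).
Proof.
move=> u0; elim: k => [|k IH].
  by move=> cu x; exact: (cvgV (u0 x) (cu x)).
move=> /[dup] Cu /CkS[du Du]; apply/CkS; split=> [x|v].
  exact: (differentiableV (du x) (u0 x)).
have -> : (fun x => 'D_v (fun x => (u x)^-1) x) =
    (fun x => (-1) * ((u x)^-1 * ((u x)^-1 * 'D_v u x))).
  apply/funext => x; rewrite deriveV//; last exact: diff_derivable.
  by rewrite expr2 invfM scaleNr mulN1r; congr (- _); exact: esym (mulrA _ _ _).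
apply: CkM; first exact: Ck_cst.
by do 2?[apply: CkM]; rewrite //; apply/IH/CkW.
Qed.

(** A derivative depends only on the germ of the map, and an identity [f = g] near [x0] also holds
    near every point of an open neighbourhood of [x0]. Hence the directional derivatives again agree
    locally, and induction on k applies. *)
Lemma Ck_local V k (f : 'rV[R]_n -> V) :
  (forall x0 : 'rV[R]_n, exists2 g, Ck k g & \forall x \near x0, f x = g x) ->
    Ck k f.
Proof.
elim: k f => [|k IH] f locf.
  move=> x0; have [g Cg fg] := locf x0.
  rewrite /continuous_at (nbhs_singleton fg).
  apply: cvg_trans (Cg x0); apply: (@near_eq_cvg _ _ (nbhs x0) _ g f).
  by apply: filterS fg => x /= ->.
apply/CkS; split=> [x0|v].
  have [g /CkS[dg _] fg] := locf x0.
  have fg0 : f \o shift x0 = cst (f x0) + 'd g x0 +o_ 0 id.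
    apply/eqaddoP => e e0.
    have /eqaddoP/(_ e e0) := diff_locally (dg x0).
    have fgs : \forall h \near 0, f (h + x0) = g (h + x0).
      by move: fg; rewrite (near_shift 0)/= subr0.
    rewrite (nbhs_singleton fg).
    by apply: filterS2 fgs => h /=; rewrite !fctE /= => ->.
  have E : 'd f x0 = 'd g x0 :> (_ -> _).
    by apply: diff_unique fg0; exact: diff_continuous.
  by apply/diff_locallyP; rewrite E; split=> //; exact: diff_continuous.
apply: IH => x0; have [g /CkS[dg Dg] fg] := locf x0.
exists (fun x => 'D_v g x) => //.
have := fg; rewrite -nbhs_nearE => /nbhs_interior.
by apply: filterS => y /= /near_eq_derive; exact.
Qed.

Lemma Ck_dilate V k (f : 'rV[R]_n -> V) (c : R) :
  Ck k f -> Ck k (fun x => f (c *: x)).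
Proof.
elim: k f => [|k IH] f.
  move=> cf x.
  have sc : {for x, continuous (fun x : 'rV[R]_n => c *: x)}.
    exact: scaler_continuous.
  exact: (continuous_comp sc (cf (c *: x))).
move=> /CkS[df Df].
have D (x : 'rV[R]_n) : is_diff x (f \o ( *:%R c)) ('d f (c *: x) \o ( *:%R c)).
  exact: is_diff_comp (is_diff_scaler c x) (differentiableP (df (c *: x))).
apply/CkS; split=> [x|v]; first by case: (D x).
have -> : (fun x => 'D_v (fun x => f (c *: x)) x) =
          (fun x => c *: 'D_v f (c *: x)).
  apply/funext => x; have [d E] := D x.
  by rewrite (deriveE _ d) E deriveE//= linearZ.
exact: CkZ (IH _ (Df v)).
Qed.
End CkCalculus.

(** * A smooth step function *)

Section FlatFunction.
Context {R : realType}.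
Implicit Types (m k : nat) (t : R).

(* The factors t^-m make the family closed under differentiation. *)
Definition flat m t : R := if 0 < t then t^-1 ^+ m * expR (- t^-1) else 0.

Lemma flat_ge0 m t : 0 <= flat m t.
Proof.
rewrite /flat; case: ifP => // t0.
by rewrite mulr_ge0 ?exprn_ge0 ?invr_ge0 ?expR_ge0// ltW.
Qed.

Lemma flat_gt0 m t : 0 < t -> 0 < flat m t.
Proof. by rewrite /flat => t0;
  rewrite t0 mulr_gt0 ?exprn_gt0 ?invr_gt0 ?expR_gt0. Qed.

Lemma flat_le0 m t : t <= 0 -> flat m t = 0.
Proof. by rewrite /flat leNgt; case: ifP. Qed.

(** Put u = 1/t: a single term of the exponential series gives [expR u] >= u^(m+1)/(m+1)!. This
    linear bound is what makes the derivative at 0 exist and vanish. *)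
Lemma flat_le m t : 0 <= t -> flat m t <= m.+1`!%:R * t.
Proof.
rewrite le_eqVlt /flat => /predU1P[<-|t0]; first by rewrite ltxx mulr0.
rewrite t0 expRN ler_pdivrMr ?expR_gt0//.
have u0 : 0 < t^-1 by rewrite invr_gt0.
have : t^-1 ^+ m.+1 / m.+1`!%:R <= expR t^-1.
  by have := expR_ge1Dxn m (ltW u0); lra.
rewrite ler_pdivrMr ?ltr0n ?fact_gt0// exprS mulrC ler_pdivrMr//.
by congr (_ <= _); ring.
Qed.

Lemma is_derive_flat m t :
  is_derive t 1 (flat m) (flat m.+2 t - m%:R * flat m.+1 t).
Proof.
have [t0|t0|->] := ltgtP t 0.
- rewrite !flat_le0 ?ltW// mulr0 subrr.
  apply: (@near_eq_is_derive _ _ _ (cst 0)).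
  by apply: filterS (lt_nbhsl t0) => x /ltW/flat_le0 ->.
- have t1 : t != 0 by rewrite gt_eqF.
  have dV : is_derive t 1 (fun x : R => x^-1) (- t ^- 2).
    rewrite -[- _]mulr1.
    exact: (@is_deriveV _ id t 1 1).
  have dN : is_derive t 1 (fun x : R => - x^-1) (t ^- 2).
    by rewrite -[t ^- 2]opprK; exact: is_deriveN.
  have dE : is_derive t 1 (expR \o (fun x : R => - x^-1))
      (expR (- t^-1) * t ^- 2).
    exact: is_derive1_comp.
  have D := is_deriveM (is_deriveX m dV) dE.
  refine (is_derive_eq (near_eq_is_derive _ D) _).
    by apply: filterS (lt_nbhsr t0) => x x0; rewrite /flat x0 !fctE.
  rewrite /flat t0 /GRing.scale /= -exprVn !fctE.
  by case: m D => [|m] _; rewrite ?exprS; ring.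
rewrite !flat_le0// mulr0 subrr.
(* The difference quotient at 0 vanishes for h < 0 and equals [flat m.+1 h] for h > 0, which
   [flat_le] sends to 0. *)
have lim0 : (h^-1 *: ((flat m \o shift 0) (h *: 1) - flat m 0)) @[h --> 0^'] -->
    (0 : R).
  apply/cvgr0Pnorm_le => e e0.
  exists (e / m.+2`!%:R); first by rewrite /= divr_gt0 ?ltr0n ?fact_gt0.
  move=> h /=; rewrite sub0r normrN ltr_pdivlMr ?ltr0n ?fact_gt0// => he _.
  rewrite addr0 [h *: 1]mulr1 (flat_le0 _ (lexx 0)) subr0.
  have [h0|h0] := leP h 0; first by rewrite flat_le0// scaler0 normr0 ltW.
  have -> : h^-1 *: flat m h = flat m.+1 h.
    by rewrite /flat h0 exprS -mulrA.
  rewrite ger0_norm ?flat_ge0//; apply: le_trans (flat_le _ (ltW h0)) _.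
  by rewrite mulrC -(gtr0_norm h0) ltW.
by apply: DeriveDef; [apply/cvg_ex; exists 0|exact/cvg_lim].
Qed.

Lemma flat_bounded m t : flat m t <= m`!%:R.
Proof.
rewrite /flat; case: ifP => [t0|_]; last exact: ler0n.
have u0 : 0 < t^-1 by rewrite invr_gt0.
rewrite expRN ler_pdivrMr ?expR_gt0//; case: m => [|m].
  by rewrite expr0 fact0 mul1r -expR0 ler_expR ltW.
rewrite mulrC -ler_pdivrMr ?ltr0n ?fact_gt0//.
by have := expR_ge1Dxn m (ltW u0); lra.
Qed.

(** By the mean value theorem: the derivative of [flat 0] is [flat 2], which is bounded by 2! =
    2. *)
Lemma flat_lipschitz s t : `|flat 0 s - flat 0 t| <= 2 * `|s - t|.
Proof.
wlog st : s t / s <= t.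
  by move=> H; case: (leP s t) => [/H //|/ltW/H]; rewrite distrC (distrC t).
have dflat (x : R) : is_derive x 1 (flat 0) (flat 2 x).
  by apply: (is_derive_eq (is_derive_flat 0 x)); rewrite mul0r subr0.
have cflat : {within `[s, t], continuous (flat 0)}.
  by apply: derivable_within_continuous => x _; exact: ex_derive.
have [c _ E] := MVT_segment st (fun x _ => dflat x) cflat.
rewrite distrC E normrM distrC ler_wpM2r// ger0_norm ?flat_ge0//.
exact: flat_bounded.
Qed.

End FlatFunction.

Section SmoothStep.
Context {R : realType}.
Implicit Types s t : R.

Definition step_den t : R := flat 0 t + flat 0 (1 - t).

Definition smooth_step t : R := flat 0 t / step_den t.

(** One of t and 1 - t is at least 1/2, and there [flat 0] is at least e^-2. *)
Lemma step_den_ge t : expR (- 2) <= step_den t.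
Proof.
have half s : 2^-1 <= s -> expR (- 2) <= flat 0 s :> R.
  move=> hs; have s0 : 0 < s by lra.
  rewrite /flat s0 expr0 mul1r ler_expR lerN2 -[leRHS]invrK.
  by rewrite lef_pV2 ?posrE// invr_gt0.
rewrite /step_den; have [/half|h] := leP 2^-1 t.
  by move=> H; apply: le_trans H _; rewrite lerDl flat_ge0.
have /half H : 2^-1 <= 1 - t by lra.
by apply: le_trans H _; rewrite lerDr flat_ge0.
Qed.

Lemma step_den_gt0 t : 0 < step_den t.
Proof. by rewrite (lt_le_trans _ (step_den_ge t))// expR_gt0. Qed.

Lemma smooth_step_ge0 t : 0 <= smooth_step t.
Proof. by rewrite divr_ge0 ?flat_ge0// ltW// step_den_gt0. Qed.

Lemma smooth_step_le1 t : smooth_step t <= 1.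
Proof. by rewrite ler_pdivrMr ?step_den_gt0// mul1r lerDl flat_ge0. Qed.

Lemma smooth_step_le0 t : t <= 0 -> smooth_step t = 0.
Proof. by move=> t0; rewrite /smooth_step flat_le0// mul0r. Qed.

Lemma smooth_step_ge1 t : 1 <= t -> smooth_step t = 1.
Proof.
move=> t1; rewrite /smooth_step /step_den (@flat_le0 _ _ (1 - t)) ?addr0.
  by rewrite divff// gt_eqF// flat_gt0// (lt_le_trans ltr01).
by rewrite subr_le0.
Qed.

Lemma smooth_step_lipschitz :
  exists2 L : R, 0 < L &
    forall s t, `|smooth_step s - smooth_step t| <= L * `|s - t|.
Proof.
have e0 : 0 < expR (- 2) :> R by exact: expR_gt0.
exists (4 / (expR (- 2) * expR (- 2))); first by rewrite divr_gt0// mulr_gt0.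
move=> s t; rewrite /smooth_step.
have sd := step_den_gt0 s; have td := step_den_gt0 t.
(* On cross-multiplying, [flat 0 s * flat 0 t] cancels. Both remaining differences are Lipschitz
   with constant 2 and their cofactors are at most 1, whence the 4. *)
have -> : flat 0 s / step_den s - flat 0 t / step_den t =
    ((flat 0 s - flat 0 t) * flat 0 (1 - t) +
     flat 0 t * (flat 0 (1 - t) - flat 0 (1 - s))) / (step_den s * step_den t).
  rewrite /step_den in sd td *; field.
  by rewrite !gt_eqF.
rewrite normrM normfV (gtr0_norm (mulr_gt0 sd td)).
rewrite [leRHS]mulrAC; apply: ler_pM => //.
- by rewrite invr_ge0 mulr_ge0// ltW.
- apply: le_trans (ler_normD _ _) _; rewrite !normrM.
  have h1 u : `|flat 0 u| <= 1 :> R.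
  by rewrite ger0_norm ?flat_ge0// -[1]/(0`!%:R) flat_bounded.
  have l1 := flat_lipschitz s t; have l2 := flat_lipschitz (1 - t) (1 - s).
  rewrite (_ : 1 - t - (1 - s) = s - t) in l2; last by ring.
  rewrite (_ : 4 * `|s - t| = 2 * `|s - t| * 1 + 1 * (2 * `|s - t|)); last by ring.
  by rewrite lerD// ler_pM.
- by rewrite lef_pV2 ?posrE ?mulr_gt0// ler_pM ?step_den_ge ?ltW.
Qed.
End SmoothStep.

Section CkSmoothStep.
Context {R : realType} {n : nat}.
Implicit Types (m k : nat) (i : 'I_n) (a b : R).

Definition affine_coord i a b : 'rV[R]_n -> R := fun x => a * x ord0 i + b.

Lemma is_diff_affine i a b x :
  is_diff x (affine_coord i a b) (fun v : 'rV[R]_n => a * v ord0 i).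
Proof.
set L := fun v : 'rV[R]_n => a * v ord0 i.
have linL : linear L.
  by move=> c u v; rewrite /L !mxE mulrDr mulrCA.
pose LM := GRing.isLinear.Build _ _ _ _ _ linL.
pose LL : {linear 'rV[R]_n -> R} := HB.pack L LM.
have cL : continuous LL.
  move=> y; have C := @coord_continuous R 1 n ord0 i y.
  exact: (cvgMl_tmp C).
have dL : is_diff x LL LL.
  by apply: DiffDef; [exact: linear_differentiable|exact: diff_lin].
apply: (is_diff_eq (is_diffD dL (is_diff_cst b x))).
by apply/funext => v; rewrite !fctE addr0.
Qed.

Lemma is_diff_flat_affine m i a b x :
  is_diff x (fun x : 'rV[R]_n => flat m (affine_coord i a b x))
    (fun v : 'rV[R]_n => a * v ord0 i *
       (flat m.+2 (affine_coord i a b x) - m%:R * flat m.+1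
         (affine_coord i a b x))).
Proof.
have [df E] := is_derive_flat m (affine_coord i a b x).
have dfx : differentiable (flat m) (affine_coord i a b x) by exact/derivable1_diffP.
have [dax Eax] := is_diff_affine i a b x.
apply: DiffDef; first exact: (differentiable_comp dax dfx).
rewrite (@diff_comp _ _ _ _ (affine_coord i a b))//.
by apply/funext => v /=; rewrite diff1E// derive1E E Eax.
Qed.

(** The induction on k treats all m at once, because differentiating [flat m] produces [flat m.+2]
    and [flat m.+1]. *)
Lemma Ck_flat k m i a b : Ck k (fun x : 'rV[R]_n => flat m (a * x ord0 i + b)).
Proof.
have df m' x : differentiable (fun x : 'rV[R]_n =>
  flat m' (affine_coord i a b x)) x.
  by case: (is_diff_flat_affine m' i a b x).
elim: k m => [|k IH] m; first by move=> x; exact/differentiable_continuous/df.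
apply/CkS; split=> [x|v]; first exact: df.
have -> : (fun x => 'D_v (fun x : 'rV[R]_n => flat m (a * x ord0 i + b)) x) =
  (fun x => (a * v ord0 i) * (flat m.+2 (a * x ord0 i + b) +
               (- m%:R) * flat m.+1 (a * x ord0 i + b))).
  apply/funext => x; rewrite deriveE; last exact: df.
  by case: (is_diff_flat_affine m i a b x) => _ ->; rewrite mulNr.
apply: CkM; first exact: Ck_cst.
apply: CkD; first exact: IH.
by apply: CkM; [exact: Ck_cst|exact: IH].
Qed.

Lemma Ck_smooth_step k i a b :
  Ck k (fun x : 'rV[R]_n => smooth_step (a * x ord0 i + b)).
Proof.
have Cr : Ck k (fun x : 'rV[R]_n => flat 0 (1 - (a * x ord0 i + b))).
  under eq_fun do rewrite opprD addrCA -mulNr.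
  exact: Ck_flat.
apply: CkM; first exact: Ck_flat.
apply: CkV => [x|]; first by rewrite gt_eqF// step_den_gt0.
by apply: CkD => //; exact: Ck_flat.
Qed.

End CkSmoothStep.

(** * Averages over lattice cubes *)

Section LatticeBox.
Context {n : nat}.
Implicit Types (c k : 'rV[int]_n) (r : nat).

(** Listing the cube by its offset functions makes the cardinality immediate and lets sums of
    products over the cube factor by distributivity. *)
Definition box c r : seq 'rV[int]_n :=
  [seq c + \row_i ((e i)%:Z - r%:Z) | e : {ffun 'I_n -> 'I_r.*2.+1}].

Let box_inj c r : injective (fun e : {ffun 'I_n -> 'I_r.*2.+1} =>
  c + \row_i ((e i)%:Z - r%:Z)).
Proof.
move=> e e' /addrI/rowP ee'; apply/ffunP => i; apply/val_inj.
by have := ee' i; rewrite !mxE => /addIr[].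
Qed.

Lemma box_uniq c r : uniq (box c r).
Proof. by rewrite map_inj_uniq ?enum_uniq//; exact: box_inj. Qed.

Lemma size_box c r : size (box c r) = (r.*2.+1 ^ n)%N.
Proof. by rewrite size_map -cardE card_ffun !card_ord. Qed.

Lemma mem_box c r k :
  reflect (forall i, `|k ord0 i - c ord0 i| <= r%:Z) (k \in box c r).
Proof.
apply: (iffP mapP) => [[e _ ->] i|kc].
  rewrite !mxE addrAC subrr add0r; move: (nat_of_ord _) (ltn_ord (e i)) => a; lia.
have ltr i : (absz (k ord0 i - c ord0 i + r%:Z)%R < r.*2.+1)%N.
  by move: (k ord0 i - c ord0 i) (kc i) => a; lia.
exists [ffun i => Ordinal (ltr i)]; first by rewrite mem_enum.
apply/rowP => i; rewrite !mxE ffunE /=.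
rewrite gez0_abs; last by move: (k ord0 i - c ord0 i) (kc i) => a; lia.
by rewrite addrK addrC subrK.
Qed.

Lemma sum_box_prod (T : comPzSemiRingType) c r (g : 'I_n -> int -> T) :
  \sum_(k <- box c r) \prod_i g i (k ord0 i) =
  \prod_i \sum_(m < r.*2.+1) g i (c ord0 i + (m%:Z - r%:Z)).
Proof.
rewrite bigA_distr_bigA big_image /=; apply: eq_bigr => e _.
by apply: eq_bigr => i _; rewrite !mxE.
Qed.

End LatticeBox.

Section Average.
Context {R : realType} {V : normedModType R} {T : eqType}.
Implicit Types (s : seq T) (v : T -> V).

Definition avg s v : V := (size s)%:R^-1 *: \sum_(l <- s) v l.

Lemma avgB s v c : (0 < size s)%N -> avg s v - c = avg s (fun l => v l - c).
Proof.
move=> s0; rewrite /avg big_split/= scalerDr sumrN big_const_seq count_predT.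
rewrite iter_addr addr0 -(scaler_nat _ c) scalerN scalerA mulVf ?scale1r//.
by rewrite pnatr_eq0 -lt0n.
Qed.

Lemma ler_norm_sum_const s (P : pred T) v A : (forall l, l \in s -> P l ->
  `|v l| <= A) ->
  `|\sum_(l <- s | P l) v l| <= (count P s)%:R * A.
Proof.
move=> vA; apply: le_trans (ler_norm_sum _ _ _) _.
have -> : (count P s)%:R * A = \sum_(l <- s | P l) A.
  by rewrite big_const_seq iter_addr addr0 mulr_natl.
by rewrite big_seq_cond [leRHS]big_seq_cond ler_sum// => l /andP[]; exact: vA.
Qed.

Lemma avg_le s v c A : (0 < size s)%N -> (forall l, l \in s -> `|v l - c| <= A) ->
  `|avg s v - c| <= A.
Proof.
move=> s0 vA; rewrite avgB// /avg normrZ normfV normr_nat ler_pdivrMl ?ltr0n//.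
by have := @ler_norm_sum_const s predT _ A (fun l ls _ => vA l ls);
  rewrite count_predT.
Qed.

(** Subtract c from all values. Passing from s to s' changes the normalisation of the old sum and
    adds [size s' - size s] new terms; each of the two effects costs at most A (1 - |s|/|s'|). *)
Lemma avg_subset s s' v c A : uniq s -> uniq s' -> {subset s <= s'} ->
  (0 < size s)%N -> (forall l, l \in s' -> `|v l - c| <= A) ->
  `|avg s v - avg s' v| <= 2 * A * (1 - (size s)%:R / (size s')%:R).
Proof.
move=> us us' ss' s0 vA.
have lss' : (size s <= size s')%N by exact: uniq_leq_size.
have s'0 : (0 < size s')%N by exact: leq_trans s0 lss'.
pose u l := v l - c.
have -> : avg s v - avg s' v = avg s u - avg s' u.
  by rewrite -!avgB// opprB addrA subrK.
rewrite /avg.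
have ps : perm_eq [seq l <- s' | l \in s] s.
  apply: uniq_perm => //; first exact: filter_uniq.
  by move=> l; rewrite mem_filter; apply: andb_idr; exact: ss'.
have split_sum : \sum_(l <- s') u l = \sum_(l <- s) u l
  + \sum_(l <- s' | l \notin s) u l.
  by rewrite (bigID (mem s))/= -big_filter (perm_big _ ps).
have cnt : (count [predC s] s' = size s' - size s)%N.
  by rewrite -(count_predC (mem s) s') -(perm_size ps) size_filter addKn.
have u1 : `|\sum_(l <- s) u l| <= (size s)%:R * A.
  rewrite -(count_predT s); apply: ler_norm_sum_const => l ls _.
  exact/vA/ss'.
have u2 : `|\sum_(l <- s' | l \notin s) u l| <= ((size s')%:R - (size s)%:R) * A.
  by rewrite -natrB// -cnt; apply: ler_norm_sum_const => l ls' _; exact: vA.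
have A0 : 0 <= A.
  by move: u1; rewrite -ler_pdivrMl ?ltr0n//; apply: le_trans;
    rewrite mulr_ge0// invr_ge0.
rewrite split_sum scalerDr opprD addrA -scalerBl.
set a := (size s)%:R in u1 u2 *; set b := (size s')%:R in u1 u2 *.
have a0 : 0 < a by rewrite ltr0n.
have ab : a <= b by rewrite ler_nat.
have b0 : 0 < b by exact: lt_le_trans ab.
apply: le_trans (ler_normB _ _) _; rewrite !normrZ.
have -> : 2 * A * (1 - a / b) = (a^-1 - b^-1) * (a * A) + b^-1 * ((b - a) * A).
  by field; rewrite !gt_eqF.
have ba : 0 <= a^-1 - b^-1 by rewrite subr_ge0 lef_pV2.
have bi : 0 <= b^-1 by rewrite invr_ge0 ltW.
by rewrite (ger0_norm ba) (ger0_norm bi) lerD// ler_wpM2l.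
Qed.
End Average.

(** Bernoulli's inequality. It is applied with x the ratio of the side lengths of two cubes, so that
    x^n is the ratio of their volumes. *)
Lemma bernoulli_le (R : realDomainType) (x : R) n :
  0 <= x <= 1 -> 1 - x ^+ n <= n%:R * (1 - x).
Proof.
move=> /andP[x0 x1]; elim: n => [|n IH]; first by rewrite subrr mul0r.
have xn : x ^+ n <= 1 by exact: exprn_ile1.
rewrite exprS -natr1; have := exprn_ge0 n x0; nra.
Qed.

Section SupNorm.
Context {R : realType} {n : nat}.
Implicit Types (x : 'rV[R]_n) (k l : 'rV[int]_n).

Lemma rV_coord_le x i : `|x ord0 i| <= `|x|.
Proof.
rewrite [leRHS]/Num.Def.normr /= mx_normrE; apply/bigmax_geP; right => /=.
by exists (ord0, i).
Qed.

Lemma rV_norm_le x e : 0 <= e -> (forall i, `|x ord0 i| <= e) -> `|x| <= e.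
Proof.
move=> e0 xe; rewrite /Num.Def.normr /= mx_normrE; apply/bigmax_leP; split=> //.
by move=> [i j] _ /=; rewrite ord1.
Qed.

Definition lattice_pt k : 'rV[R]_n := map_mx intr k.

Lemma lattice_dist k l s : (forall i, `|k ord0 i - l ord0 i| <= s%:Z) ->
  `|lattice_pt k - lattice_pt l| <= s%:R.
Proof.
move=> kl; apply: rV_norm_le => // i.
by rewrite !mxE -intrB -intr_norm -[s%:R]/(s%:Z%:~R) ler_int.
Qed.

Lemma near_minimizer (E : set 'rV[R]_n) x : E !=set0 ->
  exists2 p, E p & forall z, E z -> `|x - p| <= `|x - z| + 1.
Proof.
move=> [z0 Ez0]; pose D := [set `|x - z| | z in E].
have hD : has_inf D.
  split; first by exists `|x - z0|, z0.
  by exists 0 => _ [z _ <-].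
have [_ [p Ep <-] pD] := inf_adherent ltr01 hD.
exists p => // z Ez; apply: le_trans (ltW pD) _; rewrite lerD2r.
by apply: ge_inf; [case: hD|exists z].
Qed.
End SupNorm.

(** * Moduli of continuity *)

Section Modulus.
Context {R : realType}.
Implicit Types (w : R -> R) (C s t a : R).

(* The last condition is s / w s <= C * (t / w t), free of divisions. *)
Definition modulus w C := [/\ forall t, 0 <= w t,
  {homo w : s t / s <= t} &
  forall s t, 0 < s -> s <= t -> s * w t <= C * t * w s].

(** The ratio condition between s and a s is a doubling estimate, and monotonicity passes from a s
    to t. *)
Lemma modulus_scale w C s a t : modulus w C ->
  0 < s -> 1 <= a -> t <= a * s -> w t <= C * a * w s.
Proof.
move=> [w0 wh wg] s0 a1 ts; apply: le_trans (wh _ _ ts) _.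
have /wg : s <= a * s by rewrite ler_peMl// ltW.
move=> /(_ s0) H; rewrite -(ler_pM2l s0).
by rewrite (_ : s * (C * a * w s) = C * (a * s) * w s)//; ring.
Qed.

(** Stated with the sup norm and without division, so that x = y is allowed; the Euclidean seminorm
    is recovered at the end. *)
Definition modulus_bound {n} {V : normedModType R} w M (E : set 'rV[R]_n)
    (f : 'rV[R]_n -> V) :=
  forall x y, E x -> E y -> `|f x - f y| <= M * w `|x - y|.

End Modulus.

(** * Extension from E to the lattice by averages over cubes *)

Section LatticeExtension.
Context {R : realType} {n : nat} {V : normedModType R}.
Variables (w : R -> R) (C M : R) (E : set 'rV[R]_n) (f : 'rV[R]_n -> V).
Variable p : 'rV[int]_n -> 'rV[R]_n.
Hypotheses (wC : modulus w C) (M0 : 0 <= M) (fM : modulus_bound w M E f).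
Hypothesis Ep : forall k, E (p k).
Hypothesis p_min :
  forall k z, E z -> `|lattice_pt k - p k| <= `|lattice_pt k - z| + 1.

Implicit Types k l : 'rV[int]_n.

Let dst k : R := `|lattice_pt k - p k|.

(* The radius vanishes near E: there box_average only sees nearby values of f. *)
Definition radius k := Num.trunc (dst k / 6).

Definition box_average k : V := avg (box k (radius k)) (f \o p).

Let dst_le k l (s : nat) : (forall i, `|k ord0 i - l ord0 i| <= s%:Z) ->
  dst k <= dst l + s%:R + 1.
Proof.
move=> kl; apply: le_trans (p_min k (Ep l)) _; rewrite lerD2r [leRHS]addrC.
rewrite -[lattice_pt k - _](subrKA (lattice_pt l)).
by apply: le_trans (ler_normD _ _) _; rewrite lerD2r lattice_dist.
Qed.

(** A move by s changes [dst] by at most s + 1 <= 2 s, hence [dst / 6] by less than s. *)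
Let radius_le k l (s : nat) : (0 < s)%N ->
  (forall i, `|k ord0 i - l ord0 i| <= s%:Z) -> (radius k <= radius l + s)%N.
Proof.
move=> s0 /dst_le kl.
rewrite /radius truncn_le_nat -addSn natrD.
have := truncnS_gt (dst l / 6).
have : 1 <= s%:R :> R by rewrite ler1n.
lra.
Qed.

(* Both averages are compared with the average over the cube of radius r + 2s
   centred at k, which contains the two cubes. *)
Lemma box_average_osc k l (s : nat) : (0 < s)%N ->
  (forall i, `|k ord0 i - l ord0 i| <= s%:Z) ->
  `|box_average k - box_average l| <= 204 * n%:R * C * M * w s%:R.
Proof.
move=> s0 kl; set r := radius k; set r' := radius l.
have lk i : `|l ord0 i - k ord0 i| <= s%:Z by rewrite distrC.
have rr' := radius_le s0 kl; have r'r := radius_le s0 lk.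
set B := box k (r + s.*2).
have Bk : {subset box k r <= B}.
  move=> j /mem_box jk; apply/mem_box => i; apply: le_trans (jk i) _.
  by rewrite lez_nat leq_addr.
have Bl : {subset box l r' <= B}.
  move=> j /mem_box jk; apply/mem_box => i.
  have -> : j ord0 i - k ord0 i = (j ord0 i - l ord0 i) + (l ord0 i - k ord0 i).
    by rewrite addrA subrK.
  apply: le_trans (ler_normD _ _) _; apply: le_trans (lerD (jk i) (lk i)) _.
  by rewrite -PoszD lez_nat -addnn addnA leq_add2r.
have rR0 : 0 <= r%:R :> R by exact: ler0n.
have sR : 1 <= s%:R :> R by rewrite ler1n.
have rs2 : (r + s.*2)%:R = r%:R + 2 * s%:R :> R.
  by rewrite natrD -muln2 natrM mulrC.
(* For j in B the distance from [p j] to [p k] is at most 2 [dst k] + 2 (r + 2 s) + 1, and [dst k] <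
   6 (r + 1). Since s >= 1, the total is at most 17 (r + s), and [modulus_scale] compares with s. *)
set A := 17 * C * M * ((r%:R + s%:R) / s%:R) * w s%:R.
have fB j : j \in B -> `|(f \o p) j - f (p k)| <= A.
  move=> /mem_box jk; apply: le_trans (fM (Ep j) (Ep k)) _.
  have := @modulus_scale _ w C s%:R (17 * ((r%:R + s%:R) / s%:R)) `|p j - p k| wC.
  have -> : A = M * (C * (17 * ((r%:R + s%:R) / s%:R)) * w s%:R).
    by rewrite /A; ring.
  move=> H; apply: ler_wpM2l => //; apply: H; first by rewrite ltr0n.
    have : 1 <= (r%:R + s%:R) / s%:R :> R.
      by rewrite ler_pdivlMr ?ltr0n// mul1r lerDr.
    lra.
  rewrite -mulrA mulfVK ?pnatr_eq0 -?lt0n//.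
  have := dst_le jk; have := @lattice_dist R _ _ _ _ jk; rewrite rs2.
  have := truncnS_gt (dst k / 6); rewrite -/(radius k) -/r -[r.+1%:R]natr1.
  have : `|p j - p k| <= dst j + dst k + `|lattice_pt j - lattice_pt k|.
    apply: le_trans (ler_distD (lattice_pt j) _ _) _.
    rewrite distrC -!addrA lerD2l addrC.
    exact: ler_distD.
  lra.
have kB : k \in box k r by apply/mem_box => i; rewrite subrr normr0.
have A0 : 0 <= A := le_trans (normr_ge0 _) (fB _ (Bk _ kB)).
(* A cube of radius q >= r - s falls short of the side of B by at most 6 s points, out of at least 2
   (r + s). The volume defect is thus at most 3 n s / (r + s), which cancels the growth (r + s) / s
   in A; 102 = 2 * 17 * 3. *)
have bern q : (q <= r + s.*2)%N -> r%:R <= q%:R + s%:R :> R ->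
    2 * A * (1 - (q.*2.+1 ^ n)%:R / ((r + s.*2).*2.+1 ^ n)%:R) <=
    102 * n%:R * C * M * w s%:R.
  move=> qr rqs.
  have -> : 102 * n%:R * C * M * w s%:R =
      2 * A * (n%:R * (3 * s%:R / (r%:R + s%:R))).
    by rewrite /A; field; apply/andP; split; lra.
  apply: ler_wpM2l; first by rewrite mulr_ge0.
  set b := (r + s.*2).*2.+1.
  have bE : b%:R = 2 * (r%:R + 2 * s%:R) + 1 :> R.
    by rewrite /b -natr1 -muln2 natrM rs2 mulrC.
  have qE : q.*2.+1%:R = 2 * q%:R + 1 :> R by rewrite -natr1 -muln2 natrM mulrC.
  have qb : q%:R <= r%:R + 2 * s%:R :> R by rewrite -rs2 ler_nat.
  have q0 : 0 <= q%:R :> R by exact: ler0n.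
  have b0 : 0 < b%:R :> R by rewrite ltr0n.
  rewrite !natrX -expr_div_n.
  apply: le_trans (bernoulli_le _ _) _.
    rewrite divr_ge0 ?ler0n//= ler_pdivrMr// mul1r bE qE; lra.
  apply: ler_wpM2l => //.
  have -> : 1 - q.*2.+1%:R / b%:R = (b%:R - q.*2.+1%:R) / b%:R :> R.
    by rewrite mulrBl divff// gt_eqF.
  rewrite ler_pdivrMr// mulrAC ler_pdivlMr; last by lra.
  rewrite bE qE; nra.
have sz c q : (0 < size (@box n c q))%N by rewrite size_box expn_gt0.
have H1 := avg_subset (box_uniq k r) (box_uniq _ _) Bk (sz _ _) fB.
have H2 := avg_subset (box_uniq l r') (box_uniq _ _) Bl (sz _ _) fB.
rewrite !size_box in H1 H2.
apply: le_trans (ler_distD (avg B (f \o p)) _ _) _.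
have -> : 204 * n%:R * C * M * w s%:R =
  102 * n%:R * C * M * w s%:R + 102 * n%:R * C * M * w s%:R by ring.
apply: lerD.
  by apply: le_trans H1 _; apply: bern; rewrite ?leq_addr// lerDl ler0n.
rewrite distrC; apply: le_trans H2 _; apply: bern.
  by rewrite (leq_trans r'r)// leq_add2l -addnn leq_addr.
by rewrite -natrD ler_nat.
Qed.

(** Here [dst k] <= 3 + 1 < 6, so the radius is 0 and the cube is the single point k; also 7 = 4 +
    3. *)
Lemma box_average_near k x : E x -> `|lattice_pt k - x| <= 3 ->
  box_average k = f (p k) /\ `|p k - x| <= 7.
Proof.
move=> Ex kx; have dk : dst k <= 4.
  by have := p_min k Ex; rewrite -/(dst k); lra.
split; last first.
  apply: le_trans (ler_distD (lattice_pt k) _ _) _.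
  by rewrite distrC; move: dk; rewrite /dst; lra.
apply/subr0_eq/normr0_eq0/le_anti; rewrite normr_ge0 andbT.
apply: avg_le => [|l]; first by rewrite size_box expn_gt0.
have -> : radius k = 0%N by apply/eqP; rewrite -leqn0 truncn_le_nat; lra.
move=> /mem_box lk; suff -> : l = k by rewrite subrr normr0.
by apply/rowP => i; apply/subr0_eq/normr0_eq0/le_anti; rewrite lk normr_ge0.
Qed.

End LatticeExtension.

(** * Smooth interpolation of lattice functions *)

(** The factors are exchanged one at a time, the others having norm at most 1. *)
Lemma norm_prod_sub_le (R : realDomainType) (I : Type) (s : seq I) (a b : I -> R) :
  (forall i, `|a i| <= 1) -> (forall i, `|b i| <= 1) ->
  `|\prod_(i <- s) a i - \prod_(i <- s) b i| <= \sum_(i <- s) `|a i - b i|.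
Proof.
move=> a1 b1; elim: s => [|i s IH]; first by rewrite !big_nil subrr normr0.
rewrite !big_cons; set A := \prod_(_ <- _) _ in IH *;
  set B := \prod_(_ <- _) _ in IH *.
have -> : a i * A - b i * B = (a i - b i) * B + a i * (A - B) by ring.
apply: le_trans (ler_normD _ _) _; rewrite !normrM lerD//.
  by rewrite ler_piMr// normr_prod prodr_ile1// => j _; rewrite normr_ge0 b1.
by rewrite (le_trans _ IH)// ler_piMl.
Qed.

Section Interpolation.
Context {R : realType} {n : nat} {V : normedModType R}.
Implicit Types (x y : 'rV[R]_n) (k c : 'rV[int]_n) (F : 'rV[int]_n -> V).

(** A difference of two consecutive steps, so that the sum of its integer translates telescopes. *)
Definition hat (t : R) : R := smooth_step (t + 1) - smooth_step t.

Lemma hat_ge0 t : 0 <= hat t.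
Proof.
rewrite subr_ge0; have [t0|/ltW t0] := leP t 0.
  by rewrite (smooth_step_le0 t0) smooth_step_ge0.
by rewrite (@smooth_step_ge1 _ (t + 1)) ?smooth_step_le1// lerDr.
Qed.

Lemma hat_le1 t : hat t <= 1.
Proof.
by have := smooth_step_le1 (t + 1); have := smooth_step_ge0 t; rewrite /hat; lra.
Qed.

Lemma hat_supp t : hat t != 0 -> `|t| < 1.
Proof.
rewrite ltr_norml; case: (ltP (-1) t) => [t1|t1]; last first.
  by rewrite /hat !smooth_step_le0 ?subrr ?eqxx//; lra.
case: ltP => // t2; rewrite /hat !smooth_step_ge1 ?subrr ?eqxx//; lra.
Qed.

(** After telescoping only the two end values remain, at arguments where the step is already 1 and
    0. *)
Lemma hat_sum1 (a : int) (r : nat) t : `|t - a%:~R| <= r%:R ->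
  \sum_(m < r.*2.+1) hat (t - (a + (m%:Z - r%:Z))%:~R) = 1.
Proof.
move=> ta; pose g (m : nat) := - smooth_step (t - a%:~R + r%:R + 1 - m%:R).
rewrite (eq_bigr (fun m : 'I_ _ => g m.+1 - g m)) => [|m _]; last first.
  rewrite /hat /g opprK [RHS]addrC -natr1; congr (_ - _); congr smooth_step.
    by rewrite !intrD intrN; ring.
  by rewrite !intrD intrN; ring.
rewrite -(big_mkord xpredT (fun m => g m.+1 - g m)) telescope_sumr//.
move: ta; rewrite /g ler_norml => /andP[ta1 ta2].
rewrite subr0 smooth_step_le0; last by rewrite -natr1 -muln2 natrM; lra.
by rewrite smooth_step_ge1 ?oppr0 ?add0r ?opprK//; lra.
Qed.

Definition lattice_bump x : R := \prod_(i < n) hat (x ord0 i).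

(** At each x the sum has finite support, since bumps vanish outside the open unit cube around their
    lattice point; [interpE] turns it into a sum over any box that is large enough. *)
Definition interp F x : V :=
  \sum_(k \in [set: 'rV[int]_n]) lattice_bump (x - lattice_pt k) *: F k.

Lemma lattice_bump_ge0 x : 0 <= lattice_bump x.
Proof. by apply: prodr_ge0 => i _; exact: hat_ge0. Qed.

Lemma lattice_bump_supp x k : lattice_bump (x - lattice_pt k) != 0 ->
  forall i, `|x ord0 i - (k ord0 i)%:~R| < 1.
Proof.
move=> /prodf_neq0 h i; have := h i isT; rewrite !mxE; exact: hat_supp.
Qed.

Let supp_box x c (r : nat) k :
  (forall i, `|x ord0 i - (c ord0 i)%:~R| <= r%:R) ->
  k \notin box c r -> lattice_bump (x - lattice_pt k) = 0.
Proof.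
move=> xc kc; apply/eqP/negPn/negP => /lattice_bump_supp xk.
move/negP: kc; apply; apply/mem_box => i.
have : `|(k ord0 i - c ord0 i)%:~R| < (r%:Z + 1)%:~R :> R.
  rewrite (intrD _ r) intrB (le_lt_trans (ler_distD (x ord0 i) _ _))//.
  by rewrite addrC ler_ltD// distrC.
by rewrite -intr_norm ltr_int; lia.
Qed.

Lemma lattice_bump_sum1 x c (r : nat) :
  (forall i, `|x ord0 i - (c ord0 i)%:~R| <= r%:R) ->
  \sum_(k <- box c r) lattice_bump (x - lattice_pt k) = 1.
Proof.
move=> xc; pose g i (m : int) := hat (x ord0 i - m%:~R).
transitivity (\sum_(k <- box c r) \prod_i g i (k ord0 i)).
  by apply: eq_bigr => k _; apply: eq_bigr => i _; rewrite !mxE.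
rewrite sum_box_prod big1// => i _; exact: hat_sum1.
Qed.

Lemma interpE F x c (r : nat) :
  (forall i, `|x ord0 i - (c ord0 i)%:~R| <= r%:R) ->
  interp F x = \sum_(k <- box c r) lattice_bump (x - lattice_pt k) *: F k.
Proof.
move=> xc; rewrite /interp (fsbigE (box c r)) ?box_uniq//; last first.
  by move=> k _ kc; rewrite (supp_box xc kc) scale0r.
by apply: eq_bigl => k; rewrite in_setT.
Qed.

Definition lattice_floor x : 'rV[int]_n := \row_i Num.floor (x ord0 i).

Lemma lattice_floorP x i : 0 <= x ord0 i - (lattice_floor x ord0 i)%:~R < 1.
Proof.
by rewrite mxE; have := floor_itv (x ord0 i); rewrite intrD; lra.
Qed.

Lemma lattice_floor_near x y (r : nat) i : `|x - y| <= r%:R ->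
  `|y ord0 i - (lattice_floor x ord0 i)%:~R| <= r.+1%:R.
Proof.
move=> xy; have := rV_coord_le (x - y) i; rewrite !mxE.
rewrite -natr1; have := lattice_floorP x i; rewrite mxE.
rewrite !ler_norml; move: xy; lra.
Qed.

(** On the unit ball around [x0] one fixed box carries all nonzero terms, so [interp F] is locally a
    finite sum of smooth functions. *)
Lemma Cinfty_interp F : Cinfty (interp F).
Proof.
move=> m; apply: Ck_local => x0; set c := lattice_floor x0.
exists (fun x => \sum_(k <- box c 2) lattice_bump (x - lattice_pt k) *: F k).
  apply: Ck_sum => k; apply: Ck_scalel; apply: Ck_prod => i.
  have -> : (fun x : 'rV[R]_n => hat ((x - lattice_pt k) ord0 i)) =
    (fun x => smooth_step (1 * x ord0 i + (1 - (k ord0 i)%:~R)) +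
       (-1) * smooth_step (1 * x ord0 i + (- (k ord0 i)%:~R))).
    apply/funext => x; rewrite /hat !mxE mul1r mulN1r; congr (smooth_step _ - _).
    by ring.
  apply: CkD; first exact: Ck_smooth_step.
  by apply: CkM; [exact: Ck_cst|exact: Ck_smooth_step].
apply: filterS (nbhsx_ballx x0 1 ltr01) => x; rewrite -ball_normE => /ltW xx0.
 apply: interpE => i.
exact: (@lattice_floor_near x0 x 1 i).
Qed.

(** [interp F x] is a convex combination of the values [F k] at the lattice points whose bump
    reaches x. *)
Lemma interp_near F x v A :
  (forall k, (forall i, `|x ord0 i - (k ord0 i)%:~R| < 1) -> `|F k - v| <= A) ->
  `|interp F x - v| <= A.
Proof.
move=> FA; have xc i : `|x ord0 i - (lattice_floor x ord0 i)%:~R| <= 1%:R.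
  by have := @lattice_floor_near x x 0 i; rewrite subrr normr0; exact.
rewrite (interpE _ xc) -[v]scale1r -(lattice_bump_sum1 xc) scaler_suml -sumrB.
under eq_bigr do rewrite -scalerBr.
apply: le_trans (ler_norm_sum _ _ _) _.
rewrite -[A]mul1r -(lattice_bump_sum1 xc) mulr_suml ler_sum// => k _.
rewrite normrZ (ger0_norm (lattice_bump_ge0 _)).
have [->|/lattice_bump_supp/FA] := eqVneq (lattice_bump (x - lattice_pt k)) 0.
  by rewrite !mul0r.
exact/ler_wpM2l/lattice_bump_ge0.
Qed.

End Interpolation.

(** The weights at x and at y sum to 1 over the same box, so v may be subtracted from every [F k];
    only the spread of F around v near x enters. *)
Lemma interp_lipschitz (R : realType) (n : nat) : exists2 L : R, 0 < L &
  forall (V : normedModType R) (F : 'rV[int]_n -> V) x y v A, `|x - y| <= 1 ->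
  (forall k, k \in box (lattice_floor x) 2 -> `|F k - v| <= A) ->
  `|interp F x - interp F y| <= L * A * `|x - y|.
Proof.
have [L0 L00 L0P] := @smooth_step_lipschitz R.
(* The box has 5^n points, a bump has n factors, and each hat involves two steps of Lipschitz
   constant [L0]. Adding 1 keeps the constant positive when n = 0. *)
exists ((5 ^ n)%:R * (n%:R * (2 * L0)) + 1).
  by rewrite ltr_wpDl// !mulr_ge0// ltW.
move=> V F x y v A xy FA; set c := lattice_floor x.
have xc i : `|x ord0 i - (c ord0 i)%:~R| <= 2%:R.
  by apply: lattice_floor_near; rewrite subrr normr0.
have yc i : `|y ord0 i - (c ord0 i)%:~R| <= 2%:R by exact: lattice_floor_near.
rewrite (interpE F xc) (interpE F yc).
set sx := \sum_(_ <- _) _; set sy := \sum_(_ <- _) _.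
have -> : sx - sy = \sum_(k <- box c 2)
    (lattice_bump (x - lattice_pt k) - lattice_bump (y - lattice_pt k)) *:
      (F k - v).
  under [RHS]eq_bigr do rewrite scalerBr !scalerBl.
  rewrite !sumrB -!scaler_suml (lattice_bump_sum1 xc) (lattice_bump_sum1 yc).
  by rewrite scale1r subrr subr0.
have A0 : 0 <= A.
  apply: le_trans (normr_ge0 _) (FA c _); apply/mem_box => i.
  by rewrite subrr normr0.
have LA : (5 ^ n)%:R * (n%:R * (2 * L0) * `|x - y| * A) <=
    ((5 ^ n)%:R * (n%:R * (2 * L0)) + 1) * A * `|x - y|.
  rewrite -subr_ge0 (_ : _ - _ = A * `|x - y|); first exact: mulr_ge0.
  by ring.
apply: le_trans LA; rewrite -[5%N]/(2.*2.+1) -(size_box c) -(count_predT (box c 2)).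
apply: ler_norm_sum_const => k /FA Fk _.
rewrite normrZ; apply: ler_pM => //.
apply: le_trans (norm_prod_sub_le _ _ _) _.
- by move=> i; rewrite ger0_norm ?hat_ge0// hat_le1.
- by move=> i; rewrite ger0_norm ?hat_ge0// hat_le1.
have -> : n%:R * (2 * L0) * `|x - y| = \sum_(i < n) (2 * L0 * `|x - y|).
  by rewrite sumr_const card_ord -mulrA mulr_natl.
apply: ler_sum => i _; rewrite /hat !mxE.
set a := x ord0 i - _; set b := y ord0 i - _.
have abE : a - b = (x - y) ord0 i by rewrite /a /b !mxE opprB addrA subrK.
have ab : `|a - b| <= `|x - y| by rewrite abE rV_coord_le.
have h1 := L0P (a + 1) (b + 1); have h2 := L0P a b.
rewrite (_ : a + 1 - (b + 1) = a - b) in h1; last by ring.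
have LxL : L0 * `|a - b| <= L0 * `|x - y| by rewrite ler_wpM2l// ltW.
rewrite (_ : _ - _ - _ = (smooth_step (a + 1) - smooth_step (b + 1)) -
  (smooth_step a - smooth_step b)); last by ring.
apply: le_trans (ler_normB _ _) _; lra.
Qed.

(** * Approximation at a fixed scale *)

Section UnitScale.
Context {R : realType} {n : nat} (C : R).
Hypothesis C0 : 0 < C.

Lemma approx_unit_scale : exists2 K : R, 0 < K &
  forall (w : R -> R) (V : normedModType R) (E : set 'rV[R]_n)
    (f : 'rV[R]_n -> V) (M eps : R),
  modulus w C -> E !=set0 -> 0 <= M -> modulus_bound w M E f -> 0 <= eps ->
  (forall x y, E x -> E y -> `|x - y| <= 7 -> `|f x - f y| <= eps * w `|x - y|) ->
  exists G : 'rV[R]_n -> V, [/\ Cinfty G,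
    forall x y, `|G x - G y| <= K * M * w 1 * `|x - y|,
    modulus_bound w (K * M) setT G &
    modulus_bound w (K * eps) E (fun x => f x - G x)].
Proof.
have [L L0 interpL] := interp_lipschitz R n.
set K1 : R := 204 * n%:R * C.
have K10 : 0 <= K1 by rewrite !mulr_ge0// ltW.
(* [Ka] and [Kb] serve for increments of G over distances below and above 1, each with one summand
   for the Lipschitz bound and one for the modulus bound. [Kc] serves for the error f - G, again in
   these two ranges. *)
pose Ka := 2 * L * K1 * C + 2 * L * K1 * C * C.
pose Kb := K1 * (2 + 2 * C) + K1 * (2 + 2 * C) * C.
pose Kc := 1 + 14 * C + 7 * L * C * C.
have Ka0 : 0 <= Ka by rewrite addr_ge0 ?mulr_ge0// ltW.
have Kb0 : 0 <= Kb by rewrite addr_ge0 ?mulr_ge0 ?addr_ge0 ?mulr_ge0// ltW.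
have Kc0 : 0 < Kc.
  by rewrite /Kc -addrA ltr_pwDl// addr_ge0 ?mulr_ge0// ltW.
exists (Ka + Kb + Kc); first by rewrite ltr_wpDl// addr_ge0.
set K := Ka + Kb + Kc.
move=> w V E f M eps wC E0 M0 fM e0 fe.
have [w0 wh wg] := wC.
have /choice [p pP] : forall k : 'rV[int]_n, exists p, E p /\
    forall z, E z -> `|lattice_pt k - p| <= `|lattice_pt k - z| + 1.
  by move=> k; have [p Ep pm] := near_minimizer (lattice_pt k) E0; exists p.
have Ep k : E (p k) := (pP k).1.
have pmin k := (pP k).2.
pose F := box_average f p.
have osc (k l : 'rV[int]_n) (s : nat) : (0 < s)%N ->
    (forall i, `|k ord0 i - l ord0 i| <= s%:Z) -> `|F k - F l| <= K1 * M * w s%:R.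
  exact: (box_average_osc wC M0 fM Ep pmin).
(* Near E the average is the single value [f (p k)] with [p k] within 7 of x, so the small-scale
   hypothesis applies and w 7 <= 7 C w 1. *)
have Fnear k x : E x -> `|lattice_pt k - x| <= 3 ->
  `|F k - f x| <= 7 * C * eps * w 1.
  move=> Ex kx; rewrite /F; have [-> px] := box_average_near f pmin Ex kx.
  apply: le_trans (fe _ _ (Ep k) Ex px) _.
  rewrite (_ : 7 * C * eps * w 1 = eps * (C * 7 * w 1)); last by ring.
  by rewrite ler_wpM2l// (modulus_scale wC)// ?mulr1// ler1n.
have w_small t : 0 <= t -> t <= 1 -> t * w 1 <= C * w t.
  rewrite le_eqVlt => /predU1P[<- _|t0 t1].
    by rewrite mul0r mulr_ge0// ltW.
  by have := wg _ _ t0 t1; rewrite mulr1.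
have w_large t : 1 <= t -> w t <= C * t * w 1.
  by move=> t1; apply: (modulus_scale wC); rewrite ?mulr1.
have w_large1 t : 1 <= t -> w 1 <= w t by exact: wh.
set G := interp F.
(* A lattice point whose bump reaches x differs from [lattice_floor x] in each coordinate by an
   integer of absolute value below 2. *)
have F1 (k : 'rV[int]_n) (x : 'rV[R]_n) : (forall i, `|x ord0 i -
  (k ord0 i)%:~R| < 1) ->
    forall i, `|k ord0 i - lattice_floor x ord0 i| <= 1%:Z.
  move=> xk i; have := xk i; have := lattice_floorP x i.
  set a := lattice_floor x ord0 i; set b := k ord0 i => h1 h2.
  have : `|(b - a)%:~R| < (1 + 1)%:~R :> R.
    by rewrite intrB intrD; move: h1 h2; rewrite !ltr_norml; lra.
  by rewrite -intr_norm ltr_int ltzD1.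
have F2 k (x : 'rV[R]_n) : k \in box (lattice_floor x) 2 ->
  `|lattice_pt k - x| <= 3.
  move=> /mem_box kx; apply: rV_norm_le => // i; have h1 := lattice_floorP x i.
  have : `|(k ord0 i - lattice_floor x ord0 i)%:~R| <= 2%:Z%:~R :> R.
    by rewrite -intr_norm ler_int; exact: kx.
  rewrite -[2%:Z%:~R]/(2%:R : R) intrB.
  have -> : (lattice_pt k - x) ord0 i = (k ord0 i)%:~R - x ord0 i by rewrite !mxE.
  by move: h1; rewrite !ler_norml; lra.
have Gfl x : `|G x - F (lattice_floor x)| <= K1 * M * w 1.
  by apply: interp_near => k /F1; apply: osc.
have Glip (x y : 'rV[R]_n) : `|x - y| <= 1 ->
  `|G x - G y| <= 2 * L * K1 * C * M * w 1 * `|x - y|.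
  move=> xy.
  have h := interpL _ F _ _ (F (lattice_floor x)) (K1 * M * w 2%:R) xy.
  apply: le_trans (h _) _; first by move=> k /mem_box; apply: osc.
  apply: ler_wpM2r => //; rewrite (_ : 2 * L * K1 * C * M * w 1 =
    L * (K1 * M * (C * 2 * w 1))); last by ring.
  apply: ler_wpM2l; first exact: ltW.
  apply: ler_wpM2l; first exact: mulr_ge0.
  by apply: w_large; rewrite ler1n.
(* Both values are compared with F at the floors. The coordinates of the floors differ by integers
   below t + 1, hence by at most [(Num.trunc t).+1] <= 2 t. *)
have Gfar (x y : 'rV[R]_n) : 1 <= `|x - y| ->
  `|G x - G y| <= K1 * (2 + 2 * C) * M * w `|x - y|.
  move=> xy; set t := `|x - y| in xy *.
  have Ffl : `|F (lattice_floor x) - F (lattice_floor y)| <=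
      K1 * M * w (Num.trunc t).+1%:R.
    apply: osc => // i; have := lattice_floorP x i; have := lattice_floorP y i.
    have := rV_coord_le (x - y) i; have := truncnS_gt t.
    have -> : (x - y) ord0 i = x ord0 i - y ord0 i by rewrite !mxE.
    rewrite -/t -[_.+1%:R]natr1.
    set a := lattice_floor x ord0 i; set b := lattice_floor y ord0 i.
    move=> h1 h2 h3 h4.
    have : `|(a - b)%:~R| < ((Num.trunc t).+1%:Z + 1)%:~R :> R.
      rewrite intrB (intrD _ (_.+1)) -[_.+1%:~R]natr1; move: h1 h2 h3 h4.
      by rewrite ler_norml ltr_norml; lra.
    by rewrite -intr_norm ltr_int ltzD1.
  have wt : w (Num.trunc t).+1%:R <= C * 2 * w t.
    apply: (modulus_scale wC (lt_le_trans ltr01 xy)); first by rewrite ler1n.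
    have /andP[] : (Num.trunc t)%:R <= t < (Num.trunc t).+1%:R.
      by apply: truncn_itv; exact: normr_ge0.
    by rewrite -[_.+1%:R]natr1; lra.
  have : `|G x - G y| <= `|G x - F (lattice_floor x)| +
      `|F (lattice_floor x) - F (lattice_floor y)| + `|G y - F (lattice_floor y)|.
    rewrite (distrC (G y)); apply: le_trans (ler_distD (F (lattice_floor y)) _ _) _.
    by rewrite lerD2r; exact: ler_distD.
  move=> h; apply: le_trans h _.
  have K1M : 0 <= K1 * M by exact: mulr_ge0.
  have := ler_wpM2l K1M wt; have := ler_wpM2l K1M (w_large1 _ xy).
  have := Gfl x; have := Gfl y; move: Ffl; lra.
have GfE x k : E x -> k \in box (lattice_floor x) 2 ->
  `|F k - f x| <= 7 * C * eps * w 1.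
  by move=> Ex /F2; exact: Fnear.
(* Centring at v = [f x] makes the Lipschitz constant of G next to E proportional to eps instead of
   M. *)
have GE (x y : 'rV[R]_n) : E x -> `|x - y| <= 1 ->
  `|G x - G y| <= L * (7 * C * eps * w 1) * `|x - y|.
  by move=> Ex xy; apply: (interpL _ _ _ _ (f x)) => // k; exact: GfE.
have Gf x : E x -> `|G x - f x| <= 7 * C * eps * w 1.
  move=> Ex; apply: interp_near => k /F1 kx; apply: GfE => //; apply/mem_box => i.
  exact: le_trans (kx i) _.
have w10 : 0 <= w 1 by [].
(* Every estimate below has a constant u that is one part of [Ka], [Kb] or [Kc], with complement
   v. *)
have Ku u v b : 0 <= u -> 0 <= v -> 0 <= b ->
  u + v = Ka \/ u + v = Kb \/ u + v = Kc -> u * b <= K * b.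
  move=> u0 v0 b0 uv; apply: ler_wpM2r => //; rewrite /K.
  by case: uv => [|[]]; lra.
have u0 : 0 <= 2 * L * K1 * C by rewrite !mulr_ge0// ltW.
have v0 : 0 <= K1 * (2 + 2 * C) by rewrite mulr_ge0// addr_ge0// mulr_ge0// ltW.
have uC0 : 0 <= 2 * L * K1 * C * C by rewrite mulr_ge0// ltW.
have vC0 : 0 <= K1 * (2 + 2 * C) * C by rewrite mulr_ge0// ltW.
have C14 : 0 <= 14 * C by rewrite mulr_ge0// ltW.
have LCC : 0 <= 7 * L * C * C by rewrite !mulr_ge0// ltW.
exists G; split.
- exact: Cinfty_interp.
- move=> x y; set t := `|x - y|.
  have t0 : 0 <= t by exact: normr_ge0.
  have b0 : 0 <= M * w 1 * t by rewrite !mulr_ge0.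
  rewrite -2!mulrA (mulrA M); have [xy|/ltW xy] := leP t 1.
    apply: le_trans (Glip _ _ xy) _; rewrite -2!mulrA (mulrA M).
    by apply: Ku _ _ _ u0 uC0 b0 _; left.
  apply: le_trans (Gfar _ _ xy) _; rewrite -mulrA.
  apply: le_trans (Ku _ _ _ vC0 v0 b0 _); last by right; left; rewrite addrC.
  rewrite -[leRHS]mulrA; apply: ler_wpM2l => //.
  rewrite (_ : C * _ = M * (C * t * w 1)); last by ring.
  by rewrite ler_wpM2l// w_large.
- move=> x y _ _; set t := `|x - y|.
  have t0 : 0 <= t by exact: normr_ge0.
  have b0 : 0 <= M * w t by rewrite mulr_ge0.
  rewrite -mulrA; have [xy|/ltW xy] := leP t 1.
    apply: le_trans (Glip _ _ xy) _.
    apply: le_trans (Ku _ _ _ uC0 u0 b0 _); last by left; rewrite addrC.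
    rewrite -/t [leLHS](_ : _ = 2 * L * K1 * C * M * (t * w 1)); last by ring.
    rewrite [leRHS](_ : _ = 2 * L * K1 * C * M * (C * w t)); last by ring.
    by rewrite ler_wpM2l ?w_small// mulr_ge0.
  apply: le_trans (Gfar _ _ xy) _; rewrite -mulrA.
  by apply: Ku _ _ _ v0 vC0 b0 _; right; left.
- move=> x y Ex Ey; set t := `|x - y|.
  have t0 : 0 <= t by exact: normr_ge0.
  have b0 : 0 <= eps * w t by rewrite mulr_ge0.
  rewrite -mulrA; have [xy|/ltW xy] := leP t 1.
    apply: le_trans (Ku (1 + 7 * L * C * C) (14 * C) _ _ _ b0 _) => //;
      last 2 first.
    - by rewrite addr_ge0.
    - by right; right; rewrite /Kc addrAC.
    have -> : f x - G x - (f y - G y) = (f x - f y) - (G x - G y).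
      by rewrite !opprD !opprK addrACA.
    apply: le_trans (ler_normB _ _) _; rewrite mulrDl mul1r; apply: lerD.
      by apply: fe => //; apply: le_trans xy _; rewrite ler1n.
    apply: le_trans (GE _ _ Ex xy) _; rewrite -/t.
    rewrite [leLHS](_ : _ = 7 * L * C * eps * (t * w 1)); last by ring.
    rewrite [leRHS](_ : _ = 7 * L * C * eps * (C * w t)); last by ring.
    by rewrite ler_wpM2l ?w_small// !mulr_ge0// ltW.
  apply: le_trans (Ku (14 * C) (1 + 7 * L * C * C) _ _ _ b0 _) => //; last 2 first.
  - by rewrite addr_ge0.
  - by right; right; rewrite /Kc addrA (addrC (14 * C)).
  apply: le_trans (ler_normB _ _) _.
  have hx : `|f x - G x| <= 7 * C * eps * w 1 by rewrite distrC Gf.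
  have hy : `|f y - G y| <= 7 * C * eps * w 1 by rewrite distrC Gf.
  have wt : eps * C * w 1 <= eps * C * w t.
    by rewrite ler_wpM2l ?w_large1// mulr_ge0// ltW.
  rewrite [leRHS](_ : _ = 14 * (eps * C * w t)); last by ring.
  have E7 : 7 * C * eps * w 1 = 7 * (eps * C * w 1) by ring.
  by move: hx hy wt; rewrite E7; lra.
Qed.
End UnitScale.

(** * Smooth multiples of vector-valued maps, and change of scale *)

Section CkScale.
Context {R : realType} {n : nat} {V : normedModType R}.

Lemma scale_bilinear : bilinear_for
  (GRing.Scale.Law.clone _ _ *:%R _) (GRing.Scale.Law.clone _ _ *:%R _)
  (@GRing.scale R V : R -> V -> V).
Proof.
split=> [u'|u] a x y /=.
- by rewrite scalerDl scalerA.
- by rewrite scalerDr !scalerA mulrC.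
Qed.

HB.instance Definition _ := bilinear_isBilinear.Build R R V V _ _
  (@GRing.scale R V : R -> V -> V) scale_bilinear.

Lemma is_diff_scale (u du : 'rV[R]_n -> R) (f df : 'rV[R]_n -> V) x :
  is_diff x u du -> is_diff x f df ->
  is_diff x (fun y => u y *: f y) (fun v => u x *: df v + du v *: f x).
Proof.
move=> ux fx.
have sc : continuous (fun p : R * V => p.1 *: p.2) by exact: scale_continuous.
have D : is_diff (u x, f x) (fun q : R * V => q.1 *: q.2)
    (fun q => u x *: q.2 + q.1 *: f x).
  apply: DiffDef; first exact: (@differentiable_bilin _ _ _ _
    (@GRing.scale R V : R -> V -> V)).
  exact: (@diff_bilin _ _ _ _ (@GRing.scale R V : R -> V -> V)).
exact: (@is_diff_comp _ _ _ _ (fun y => (u y, f y)) _ (fun q : R * V =>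
  q.1 *: q.2) _).
Qed.

Lemma Ck_scale k (u : 'rV[R]_n -> R) (f : 'rV[R]_n -> V) :
  Ck k u -> Ck k f -> Ck k (fun x => u x *: f x).
Proof.
elim: k u f => [|k IH] u f; first by move=> cu cf x; exact: (cvgZ (cu x) (cf x)).
move=> /[dup] Cu /CkS[du Du] /[dup] Cf /CkS[df Df].
have D x := is_diff_scale (differentiableP (du x)) (differentiableP (df x)).
apply/CkS; split=> [x|v]; first by case: (D x).
have -> : (fun x => 'D_v (fun x => u x *: f x) x) =
    (fun x => u x *: 'D_v f x + 'D_v u x *: f x).
  apply/funext => x; have [d E] := D x.
  by rewrite deriveE// E !deriveE.
exact: (CkD (IH _ _ (CkW Cu) (Df v)) (IH _ _ (Du v) (CkW Cf))).
Qed.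
End CkScale.

Section Rescaling.
Context {R : realType} {n : nat}.

Lemma modulus_dilate (w : R -> R) (C d : R) : 0 < d -> modulus w C ->
  modulus (fun t => w (d * t)) C.
Proof.
move=> d0 [w0 wh wg]; split=> [t|s t st|s t s0 st]; first exact: w0.
  by apply: wh; rewrite ler_pM2l.
rewrite -(ler_pM2l d0) mulrA.
rewrite [leRHS](_ : _ = C * (d * t) * w (d * s)); last by ring.
by apply: wg; rewrite ?mulr_gt0// ler_pM2l.
Qed.

(** Dilation by [delta / 7] turns distances up to delta into distances up to 7. The modulus
    conditions are dilation invariant with the same C, so K is independent of delta, which affects
    only the Lipschitz constant of G. *)
Lemma approx_small_scale (C : R) : 0 < C -> exists2 K : R, 0 < K &
  forall (w : R -> R) (V : normedModType R) (E : set 'rV[R]_n)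
    (f : 'rV[R]_n -> V) (M eps delta : R),
  modulus w C -> E !=set0 -> 0 <= M -> modulus_bound w M E f -> 0 < eps ->
  0 < delta ->
  (forall x y, E x -> E y -> `|x - y| <= delta ->
    `|f x - f y| <= eps * w `|x - y|) ->
  exists G : 'rV[R]_n -> V, [/\ Cinfty G,
    exists L, forall x y, `|G x - G y| <= L * `|x - y|,
    modulus_bound w (K * M) setT G &
    modulus_bound w (K * eps) E (fun x => f x - G x)].
Proof.
move=> C0; have [K K0 approx] := @approx_unit_scale R n C C0.
exists K => // w V E f M eps delta wC [z0 Ez0] M0 fM e0 delta0 fe.
pose d := delta / 7.
have d0 : 0 < d by rewrite divr_gt0.
have dn (x y : 'rV[R]_n) : `|d *: x - d *: y| = d * `|x - y|.
  by rewrite -scalerBr normrZ gtr0_norm.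
have dV x : d *: (d^-1 *: x) = x :> 'rV[R]_n by rewrite scalerA divff ?scale1r// gt_eqF.
have dVn (x y : 'rV[R]_n) : d * `|d^-1 *: x - d^-1 *: y| = `|x - y|.
  by rewrite -dn !dV.
have [|||||G [CG LG MG EG]] := approx _ V (fun x => E (d *: x)) (fun x =>
  f (d *: x)) M eps
  (modulus_dilate d0 wC).
- by exists (d^-1 *: z0); rewrite /= dV.
- by [].
- by move=> x y Ex Ey; rewrite -dn; exact: fM.
- exact: ltW.
- move=> x y Ex Ey xy; rewrite -dn; apply: fe => //.
  by rewrite dn /d mulrAC ler_pdivrMr// ler_pM2l.
exists (fun x => G (d^-1 *: x)); split.
- by move=> k; apply: Ck_dilate; exact: CG.
- exists (K * M * w (d * 1) * d^-1) => x y; apply: le_trans (LG _ _) _.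
  by rewrite -scalerBr normrZ gtr0_norm ?invr_gt0// mulrA.
- by move=> x y _ _; rewrite -dVn; exact: MG.
- by move=> x y Ex Ey; rewrite -dVn -{1}(dV x) -{1}(dV y); apply: EG; rewrite /= dV.
Qed.
End Rescaling.

(** * Compactly supported approximation *)

Section Cutoff.
Context {R : realType} {n : nat}.
Implicit Types x y : 'rV[R]_n.

Lemma rV_norm_lt x e : 0 < e -> (forall i, `|x ord0 i| < e) -> `|x| < e.
Proof.
move=> e0 xe; rewrite /Num.Def.normr /= mx_normrE; apply/bigmax_ltP; split=> //.
by move=> [i j] _ /=; rewrite ord1.
Qed.

Let bump (t : R) : R := smooth_step (2 + t) * smooth_step (2 - t).

Let bump01 t : 0 <= bump t <= 1.
Proof.
rewrite /bump mulr_ge0 ?smooth_step_ge0//=.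
by rewrite mulr_ile1 ?smooth_step_ge0 ?smooth_step_le1.
Qed.

(** For the sup norm a product of one-variable plateaus works: [bump] is 1 on [-1, 1] and 0 outside
    (-2, 2). *)
Lemma smooth_cutoff : exists2 L : R, 0 <= L & exists chi : 'rV[R]_n -> R,
  [/\ Cinfty chi, forall x, 0 <= chi x <= 1, forall x, `|x| <= 1 -> chi x = 1,
      forall x, 2 <= `|x| -> chi x = 0 &
      forall x y, `|chi x - chi y| <= L * `|x - y|].
Proof.
have [L L0 HL] := @smooth_step_lipschitz R.
exists (n%:R * (2 * L)); first by rewrite !mulr_ge0// ltW.
exists (fun x => \prod_(i < n) bump (x ord0 i)); split.
- move=> k; apply: Ck_prod => i.
  have -> : (fun x : 'rV[R]_n => bump (x ord0 i)) = (fun x =>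
      smooth_step (1 * x ord0 i + 2) * smooth_step ((-1) * x ord0 i + 2)).
    by apply/funext => x; rewrite /bump mul1r mulN1r addrC (addrC 2).
  by apply: CkM; exact: Ck_smooth_step.
- move=> x; apply/andP; split; first by apply: prodr_ge0 => i _;
  case/andP: (bump01 (x ord0 i)).
  by apply: prodr_ile1 => i _; exact: bump01.
- move=> x x1; apply: big1 => i _.
  have := le_trans (rV_coord_le x i) x1; rewrite ler_norml /bump => /andP[? ?].
  by rewrite !smooth_step_ge1 ?mulr1//; lra.
- move=> x x2; apply/eqP; apply: contraTT x2 => /prodf_neq0 h; rewrite -ltNge.
  apply: rV_norm_lt => // i; have := h i isT; apply: contraTT.
  rewrite -leNgt negbK /bump mulf_eq0.
  have [xi|xi] := leP 0 (x ord0 i).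
    by rewrite ger0_norm// => ?;
      rewrite (@smooth_step_le0 _ (2 - _)) ?eqxx ?orbT//; lra.
  by rewrite ltr0_norm// => ?; rewrite (@smooth_step_le0 _ (2 + _)) ?eqxx//; lra.
- move=> x y; apply: le_trans (norm_prod_sub_le _ _ _) _.
  + by move=> i; case/andP: (bump01 (x ord0 i)) => b0 b1; rewrite ger0_norm.
  + by move=> i; case/andP: (bump01 (y ord0 i)) => b0 b1; rewrite ger0_norm.
  have -> : n%:R * (2 * L) * `|x - y| = \sum_(i < n) (2 * L * `|x - y|).
    by rewrite sumr_const card_ord -mulrA mulr_natl.
  apply: ler_sum => i _; rewrite /bump; set a := x ord0 i; set b := y ord0 i.
  have abE : a - b = (x - y) ord0 i by rewrite /a /b !mxE.
  have ab : `|a - b| <= `|x - y| by rewrite abE rV_coord_le.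
  have := HL (2 + a) (2 + b); rewrite (_ : 2 + a - (2 + b) = a - b); last by ring.
  have := HL (2 - a) (2 - b); rewrite (_ : 2 - a - (2 - b) = b - a); last by ring.
  rewrite (distrC b) => h1 h2.
  have LxL : L * `|a - b| <= L * `|x - y| by rewrite ler_wpM2l// ltW.
  rewrite [X in `|X|](_ : _ = (smooth_step (2 + a) - smooth_step (2
    + b)) * smooth_step (2 - a)
    + smooth_step (2 + b) * (smooth_step (2 - a) - smooth_step (2 - b)));
      last by ring.
  have s1 (u : R) : `|smooth_step u| <= 1.
    by rewrite ger0_norm ?smooth_step_ge0 ?smooth_step_le1.
  apply: le_trans (ler_normD _ _) _.
  rewrite (normrM (_ - _)) (normrM (smooth_step (2 + b))).
  rewrite [leRHS](_ : _ = L * `|x - y| * 1 + 1 * (L * `|x - y|)); last by ring.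
  apply: lerD; apply: ler_pM => //; first exact: le_trans h2 LxL.
  exact: le_trans h1 LxL.
Qed.

Lemma compact_supp_le (V : normedModType R) (G : 'rV[R]_n -> V) r :
  (forall x, r < `|x| -> G x = 0) -> compact (closure [set x | G x <> 0]).
Proof.
move=> G0.
have cl : closed [set x : 'rV[R]_n | `|x| <= r].
  by apply: closed_comp (@closed_le _ r) => x _; exact: norm_continuous.
have sub : closure [set x | G x <> 0] `<=` [set x | `|x| <= r].
  rewrite [X in _ `<=` X](closure_id _).1//; apply: closure_subset => x /= Gx.
  by rewrite leNgt; apply/negP => /G0.
apply: bounded_closed_compact; last exact: closed_closure.
exists r; split; first exact: num_real.
by move=> s rs x /sub /= xr; rewrite (le_trans xr)// ltW.
Qed.

End Cutoff.

Section CompactSupport.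
Context {R : realType} {n : nat} (C : R).
Hypothesis C0 : 0 < C.

Lemma approx_compact_support : exists2 K : R, 0 < K &
  forall (w : R -> R) (V : normedModType R) (E : set 'rV[R]_n)
    (f : 'rV[R]_n -> V) (M eps : R),
  modulus w C -> (forall A, exists T, forall t, T <= t -> A <= w t) ->
  E !=set0 -> 0 <= M -> modulus_bound w M E f -> 0 < eps ->
  (exists2 d, 0 < d & forall x y, E x -> E y -> `|x - y| <= d ->
    `|f x - f y| <= eps * w `|x - y|) ->
  (exists D, forall x y, E x -> E y -> D <= `|x - y| ->
    `|f x - f y| <= eps * w `|x - y|) ->
  (exists D, forall x y, E x -> E y -> D <= `|x| -> D <= `|y| ->
    `|f x - f y| <= eps * w `|x - y|) ->
  exists G : 'rV[R]_n -> V, [/\ Cc_infty G,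
    modulus_bound w (K * M) setT G &
    modulus_bound w (K * eps) E (fun x => f x - G x)].
Proof.
have [K K0 approx] := @approx_small_scale R n C C0.
have [L L0 [chi [Cchi chi01 chi1 chi0 chiL]]] := @smooth_cutoff R n.
(* [Q] measures the cutoff at radius r in units of w, [K2] is the cost of cutting off a function
   vanishing at [x0], and [K3] that of the tail (1 - chi) (f - f x0). *)
pose Q := 1 + L * C.
have Q0 : 0 <= Q by rewrite addr_ge0// mulr_ge0// ltW.
pose K2 := 1 + Q * (3 * C).
have K20 : 0 <= K2 by rewrite addr_ge0// !mulr_ge0// ltW.
pose K3 := 1 + Q * (3 * C + 1).
have K30 : 0 < K3 by rewrite ltr_pwDl// mulr_ge0// addr_ge0// mulr_ge0// ltW.
exists (K2 * K + K3); first by rewrite ltr_wpDl// mulr_ge0// ltW.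
move=> w V E f M eps wC woo E0 M0 fM eps0 [d d0 fd] [DL fL] [DF fF].
have [w0 wh wg] := wC.
have [G1 [CG1 _ MG1 EG1]] := approx w V E f M eps d wC E0 M0 fM eps0 d0 fd.
have [x0 Ex0] := E0.
(* Once r >= T, the bound M * w DL for pairs closer than [DL] is at most eps * w r. *)
have [T wT] := woo (eps^-1 * (M * w DL)).
pose r := 1 + `|x0| + 2 * `|DL| + 2 * `|DF| + `|T|.
have [rp rx0 rDL rDF rT] : [/\ 0 < r, `|x0| <= r, 2 * DL <= r, 2 * DF <= r & T
  <= r].
  have := normr_ge0 x0; have := ler_norm DL; have := ler_norm DF;
    have := ler_norm T.
  have := normr_ge0 DL; have := normr_ge0 DF; have := normr_ge0 T.
  by rewrite /r; split; lra.
have r1 : 0 < r^-1 by rewrite invr_gt0.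
pose chir (x : 'rV[R]_n) := chi (r^-1 *: x).
have chir01 x : 0 <= chir x <= 1 by exact: chi01.
have chir1 x : `|x| <= r -> chir x = 1.
  by move=> xr; apply: chi1; rewrite normrZ gtr0_norm// ler_pdivrMl// mulr1.
have chir0 x : 2 * r <= `|x| -> chir x = 0.
  by move=> xr; apply: chi0; rewrite normrZ gtr0_norm// ler_pdivlMl// mulrC.
(* For |x - y| >= r the cutoff changes by at most 1 and w r <= w |x - y|. For smaller distances its
   slope is L / r, and the ratio condition trades |x - y| w r for C r w |x - y|. *)
have chirw (x y : 'rV[R]_n) : `|chir x - chir y| * w r <= Q * w `|x - y|.
  have LC0 : 0 <= L * C by rewrite mulr_ge0// ltW.
  rewrite /Q mulrDl mul1r; have [xy|/ltW xy] := leP r `|x - y|.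
    apply: (@le_trans _ _ (w `|x - y|)); last by rewrite lerDl mulr_ge0.
    apply: (@le_trans _ _ (1 * w r)); last by rewrite mul1r wh.
    apply: ler_wpM2r => //; move: (chir01 x) (chir01 y); rewrite ler_norml; lra.
  apply: (@le_trans _ _ (L * C * w `|x - y|)); last by rewrite lerDr.
  have tw : `|x - y| * w r <= C * r * w `|x - y|.
    have [/eqP|xy0] := boolP (`|x - y| == 0).
      by move=> ->; rewrite mul0r !mulr_ge0// ltW.
    by apply: wg => //; rewrite lt_neqAle eq_sym xy0 normr_ge0.
  have := chiL (r^-1 *: x) (r^-1 *: y); rewrite -scalerBr normrZ (gtr0_norm r1).
  move=> /(ler_wpM2r (w0 r)) h; apply: le_trans h _.
  rewrite [leLHS](_ : _ = L * r^-1 * (`|x - y| * w r)); last by ring.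
  rewrite [leRHS](_ : _ = L * r^-1 * (C * r * w `|x - y|)); last first.
    by field; rewrite gt_eqF.
  by apply: ler_wpM2l => //; rewrite mulr_ge0// ltW.
have w3 x : `|x| <= 2 * r -> w `|x - x0| <= 3 * C * w r.
  move=> xr; rewrite (mulrC 3); apply: (modulus_scale wC) => //;
    first by rewrite ler1n.
  by apply: le_trans (ler_normB _ _) _; lra.
(* In the product rule the increment of the cutoff is made to multiply g at a point within 2 r,
   where g is bounded; if both points lie beyond, both products vanish. *)
have cut (A B : R) (S : set 'rV[R]_n) (g : 'rV[R]_n -> V) : 0 <= A -> 0 <= B ->
    modulus_bound w A S g ->
    (forall x, S x -> `|x| <= 2 * r -> `|g x| <= B * w r) ->
    modulus_bound w (A + Q * B) S (fun x => chir x *: g x).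
  move=> A0 B0 gA gB.
  have half x y : S x -> S y -> `|x| <= 2 * r ->
      `|chir x *: g x - chir y *: g y| <= (A + Q * B) * w `|x - y|.
    move=> Sx Sy xr; have /andP[cy0 cy1] := chir01 y.
    have -> : chir x *: g x - chir y *: g y =
        chir y *: (g x - g y) + (chir x - chir y) *: g x.
      by rewrite scalerBr scalerBl [RHS]addrC addrA subrK.
    apply: le_trans (ler_normD _ _) _; rewrite !normrZ mulrDl; apply: lerD.
      rewrite ger0_norm//; apply: le_trans (gA _ _ Sx Sy).
      by rewrite ler_piMl.
    apply: le_trans (ler_wpM2l (normr_ge0 _) (gB _ Sx xr)) _.
    by rewrite mulrCA [leRHS]mulrAC [leRHS]mulrC ler_wpM2l.
  move=> x y Sx Sy; have [xr|/ltW xr] := leP `|x| (2 * r); first exact: half.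
  have [yr|/ltW yr] := leP `|y| (2 * r).
    by rewrite distrC (distrC x); exact: half.
  rewrite !chir0// !scale0r subrr normr0 mulr_ge0//.
  by rewrite addr_ge0// mulr_ge0.
have cutB (A : R) (S : set 'rV[R]_n) (h : 'rV[R]_n -> V) : 0 <= A -> S x0 ->
    modulus_bound w A S h ->
    modulus_bound w (K2 * A) S (fun x => chir x *: (h x - h x0)).
  move=> A0 Sx0 hA; rewrite (_ : K2 * A = A + Q * (3 * C * A)); last first.
    by rewrite /K2; ring.
  apply: cut => // [||x Sx xr].
  - by rewrite !mulr_ge0// ltW.
  - by move=> x y Sx Sy; rewrite opprB addrA subrK; exact: hA.
  apply: le_trans (hA _ _ Sx Sx0) _.
  rewrite [leRHS](_ : _ = A * (3 * C * w r)); last by ring.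
  by rewrite ler_wpM2l// w3.
(* Points at least [DL] away from [x0] use decay at large distances and [w3]; the others use the
   choice of T. *)
have f0 x : E x -> `|x| <= 2 * r -> `|f x - f x0| <= (3 * C + 1) * eps * w r.
  move=> Ex xr; have [xD|/ltW xD] := leP DL `|x - x0|.
    apply: le_trans (fL _ _ Ex Ex0 xD) _.
    rewrite [leRHS](_ : _ = eps * ((3 * C + 1) * w r)); last by ring.
    rewrite ler_wpM2l ?(ltW eps0)//.
    by apply: le_trans (w3 _ xr) _; rewrite [leRHS]mulrDl mul1r lerDl.
  apply: le_trans (fM _ _ Ex Ex0) _.
  have := wT _ rT; rewrite ler_pdivrMl// => h.
  apply: (@le_trans _ _ (M * w DL)); first by rewrite ler_wpM2l// wh.
  apply: le_trans h _; rewrite -mulrA [leRHS]mulrDl mul1r lerDr.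
  by rewrite !mulr_ge0// ltW.
have cutf : modulus_bound w (K3 * eps) E (fun x => (1 - chir x) *: (f x - f x0)).
  have KE t : K3 * eps * t = eps * t + Q * (3 * C + 1) * eps * t.
    by rewrite /K3; ring.
  have half x y : E x -> E y -> `|x| <= 2 * r ->
      `|(1 - chir x) *: (f x - f x0) - (1 - chir y) *: (f y - f x0)| <=
      K3 * eps * w `|x - y|.
    move=> Ex Ey xr; have /andP[cy0 cy1] := chir01 y.
    have -> : (1 - chir x) *: (f x - f x0) - (1 - chir y) *: (f y - f x0) =
        (1 - chir y) *: (f x - f y) - (chir x - chir y) *: (f x - f x0).
      have -> : f x - f y = (f x - f x0) -
        (f y - f x0) by rewrite opprB addrA subrK.
      set a := f x - f x0; set b := f y - f x0.
      rewrite [(1 - chir y) *: (a - b)]scalerBr addrAC -scalerBl.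
      by congr (_ *: _ - _); ring.
    apply: le_trans (ler_normB _ _) _; rewrite !normrZ KE; apply: lerD.
      have [yr|yr] := leP `|y| r.
        by rewrite (chir1 _ yr) subrr normr0 mul0r mulr_ge0// ltW.
      have c1 : `|1 - chir y| <= 1 by rewrite ler_norml; lra.
      apply: le_trans (ler_wpM2r (normr_ge0 _) c1) _; rewrite mul1r.
      (* Here |y| > r. If |x| < DF, then |x - y| > r - DF >= r / 2 >= DL, so the large-distance
         condition applies; otherwise both points are far. *)
      have [xD|xD] := leP DF `|x|; first by apply: fF => //; lra.
      apply: fL => //; have := lerB_dist y x; rewrite (distrC y); lra.
    apply: le_trans (ler_wpM2l (normr_ge0 _) (f0 _ Ex xr)) _.
    rewrite mulrCA [leRHS](_ : _ = (3 * C + 1) * eps * (Q * w `|x - y|));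
      last by ring.
    by rewrite ler_wpM2l// mulr_ge0 ?addr_ge0// ?mulr_ge0// ltW.
  move=> x y Ex Ey; have [xr|xr] := leP `|x| (2 * r); first exact: half.
  have [yr|yr] := leP `|y| (2 * r).
    by rewrite distrC (distrC x); exact: half.
  rewrite (chir0 _ (ltW xr)) (chir0 _ (ltW yr)) subr0 !scale1r opprB addrA subrK KE.
  apply: (@le_trans _ _ (eps * w `|x - y|)); first by apply: fF => //; lra.
  by rewrite lerDl !mulr_ge0// ?addr_ge0// ?mulr_ge0// ltW.
exists (fun x => chir x *: (G1 x - G1 x0)); split.
- split.
    move=> k; apply: Ck_scale; first by apply: Ck_dilate; exact: Cchi.
    by apply: CkD; [exact: CG1|exact: Ck_cst].
  by apply: (@compact_supp_le _ _ _ _ (2 * r)) => x /ltW/chir0 ->; rewrite scale0r.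
- move=> x y _ _; apply: le_trans (cutB _ _ _ (mulr_ge0
  (ltW K0) M0) I MG1 _ _ I I) _.
  by rewrite mulrA ler_wpM2r// ler_wpM2r// lerDl ltW.
move=> x y Ex Ey.
have hE := cutB _ _ _ (mulr_ge0 (ltW K0) (ltW eps0)) Ex0 EG1 _ _ Ex Ey.
have hf := cutf _ _ Ex Ey.
(* With e = f - G1, the error is the sum of (1 - chi) (f - f x0) and
   chi (e - e x0), up to a constant. *)
have split_f z : f z - chir z *: (G1 z - G1 x0) = f x0 +
    ((1 - chir z) *: (f z - f x0) + chir z *: (f z - G1 z - (f x0 - G1 x0))).
  have -> : f z - G1 z - (f x0 - G1 x0) = (f z - f x0) - (G1 z - G1 x0).
    by rewrite !opprD !opprK addrACA.
  rewrite scalerBl scale1r (scalerBr _ (f z - f x0) (G1 z - G1 x0)) subrKA.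
  by rewrite addrA subrKC.
rewrite (split_f x) (split_f y) (addrC (f x0)) addrKA.
have subrACA (a b c e : V) : (a + b) - (c + e) = (a - c) + (b - e).
  by rewrite opprD addrACA.
rewrite (subrACA ((1 - chir x) *: _)).
apply: le_trans (ler_normD _ _) _; rewrite [leRHS](_ : _ =
  K3 * eps * w `|x - y| + K2 * (K * eps) * w `|x - y|); last by ring.
exact: lerD hf hE.
Qed.
End CompactSupport.

(** * From the Euclidean to the sup norm *)

Section EuclideanNorm.
Context {R : realType} {n : nat}.
Implicit Types x y : 'rV[R]_n.

Lemma norm_le_enorm x : `|x| <= enorm x.
Proof.
apply: rV_norm_le; first exact: sqrtr_ge0.
move=> i; rewrite -sqrtr_sqr ler_wsqrtr// (bigD1 i)//= lerDl sumr_ge0// => j _.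
exact: sqr_ge0.
Qed.

(** The factor n + 1 replaces sqrt n so as to be at least 1 also for n = 0, as [modulus_scale]
    requires. *)
Lemma enorm_le_norm x : enorm x <= n.+1%:R * `|x|.
Proof.
rewrite -[leRHS]ger0_norm ?mulr_ge0// -sqrtr_sqr ler_wsqrtr//.
apply: (@le_trans _ _ (\sum_(i < n) `|x| ^+ 2)).
  apply: ler_sum => i _; rewrite -real_normK ?num_real//.
  by rewrite lerXn2r ?nnegrE ?normr_ge0// rV_coord_le.
rewrite sumr_const card_ord exprMn -[_ *+ n]mulr_natl ler_wpM2r ?sqr_ge0//.
by rewrite -natrX ler_nat (leq_trans (leqnSn n))// leq_pmulr.
Qed.

Lemma enorm_gt0 x y : x <> y -> 0 < enorm (x - y).
Proof.
move=> /eqP xy; apply: lt_le_trans (norm_le_enorm _).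
by rewrite normr_gt0 subr_eq0.
Qed.
End EuclideanNorm.

(** * Suprema of difference quotients and the modulus extended by zero *)

Section OscillationSup.
Context {R : realType} {n : nat} {V : normedModType R} {w : R -> R}.
Hypothesis w_pos : forall t, 0 < t -> 0 < w t.
Implicit Types (E : set 'rV[R]_n) (P : 'rV[R]_n -> 'rV[R]_n -> Prop)
  (f : 'rV[R]_n -> V).

Lemma osc_sup_ge0 E P f : (0 <= osc_sup w E P f)%E.
Proof. by apply: ereal_sup_ubound; left. Qed.

Lemma osc_supP E P f A : (osc_sup w E P f <= A%:E)%E <-> 0 <= A /\
  forall x y, E x -> E y -> x <> y -> P x y ->
    `|f x - f y| <= A * w (enorm (x - y)).
Proof.
split=> [fA|[A0 fA]].
  split; first by rewrite -lee_fin; exact: le_trans (osc_sup_ge0 E P f) fA.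
  move=> x y Ex Ey xy Pxy; have wxy := w_pos (enorm_gt0 xy).
  rewrite -ler_pdivrMr// -lee_fin; apply: le_trans fA.
  by apply: ereal_sup_ubound; right; exists x, y.
apply: ge_ereal_sup => _ [->|[x [y [Ex Ey xy Pxy ->]]]]; first by rewrite lee_fin.
by rewrite lee_fin ler_pdivrMr ?w_pos ?enorm_gt0//; exact: fA.
Qed.

Lemma osc_sup_set0 P f : osc_sup w set0 P f = 0%E.
Proof.
apply/eqP; rewrite eq_le osc_sup_ge0 andbT.
by apply/osc_supP; split=> // x y [].
Qed.

(** The filter set Q lets the chosen d meet a side condition, such as positivity. *)
Lemma osc_sup_cvg0 (F : set_system R) (Fil : ProperFilter F) E
    (P : R -> 'rV[R]_n -> 'rV[R]_n -> Prop) f (Q : set R) eta :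
  osc_sup w E (P d) f @[d --> F] --> 0%E -> F Q -> 0 < eta ->
  exists2 d, Q d & forall x y, E x -> E y -> x <> y -> P d x y ->
    `|f x - f y| <= eta * w (enorm (x - y)).
Proof.
move=> f0 FQ eta0.
have Flt : F [set d | (osc_sup w E (P d) f < eta%:E)%E].
  exact: f0 _ (@nbhs_open_ereal_lt _ 0 (fun=> eta) eta0).
have [d [Qd /ltW/osc_supP[_ fd]]] := filter_ex (filterI FQ Flt).
by exists d.
Qed.
End OscillationSup.

Section ExtendedModulus.
Context {R : realType} {n : nat} {V : normedModType R} (w : R -> R) (Cw : R).
Hypothesis w_pos : forall t, 0 < t -> 0 < w t.
Hypothesis w_nondecreasing : forall s t, 0 < s -> s <= t -> w s <= w t.
Hypothesis w_ratio : forall s t, 0 < s -> s <= t -> s / w s <= Cw * (t / w t).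
Hypothesis Cw0 : 0 < Cw.

(* The hypotheses on w say nothing about w t for t <= 0. *)
Definition extended (t : R) := if 0 < t then w t else 0.

Lemma extended_gt0 t : 0 < t -> extended t = w t.
Proof. by rewrite /extended => ->. Qed.

Lemma extended_modulus : modulus extended Cw.
Proof.
rewrite /extended; split=> [t|s t st|s t s0 st].
- by case: ifP => // /w_pos/ltW.
- case: ifP => [s0|_]; first by rewrite (lt_le_trans s0 st) w_nondecreasing.
  by case: ifP => // /w_pos/ltW.
have t0 := lt_le_trans s0 st; rewrite s0 t0.
have := w_ratio s0 st; rewrite mulrA ler_pdivrMr ?w_pos// mulrAC.
by rewrite ler_pdivlMr ?w_pos.
Qed.

(** The price of replacing the Euclidean by the sup norm inside w: the norm ratio n + 1 times the
    doubling constant. *)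
Let N : R := Cw * n.+1%:R.

Lemma extended_le_enorm (x : 'rV[R]_n) : extended `|x| <= extended (enorm x).
Proof. by case: extended_modulus => _ + _; apply; exact: norm_le_enorm. Qed.

Lemma extended_enorm_le (x y : 'rV[R]_n) : x <> y ->
  w (enorm (x - y)) <= N * extended `|x - y|.
Proof.
move=> xy; rewrite -extended_gt0 ?enorm_gt0//.
apply: (modulus_scale extended_modulus).
- by rewrite normr_gt0 subr_eq0; exact/eqP.
- by rewrite ler1n.
- exact: enorm_le_norm.
Qed.

Lemma enorm_modulus_bound (E : set 'rV[R]_n) (f : 'rV[R]_n -> V) M : 0 <= M ->
  (forall x y, E x -> E y -> x <> y -> `|f x - f y| <= M * w (enorm (x - y))) ->
  modulus_bound extended (M * N) E f.
Proof.
move=> M0 fM x y Ex Ey; have [e_ge0 _ _] := extended_modulus.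
have [->|/eqP xy] := eqVneq x y.
  by rewrite subrr normr0 mulr_ge0// mulr_ge0// mulr_ge0// ltW.
apply: le_trans (fM _ _ Ex Ey xy) _.
by rewrite -mulrA ler_wpM2l// extended_enorm_le.
Qed.

Lemma modulus_bound_seminorm (E : set 'rV[R]_n) (f : 'rV[R]_n -> V) M : 0 <= M ->
  modulus_bound extended M E f -> (holder_seminorm w E f <= M%:E)%E.
Proof.
move=> M0 fM; apply/(osc_supP w_pos); split=> // x y Ex Ey xy _.
rewrite -extended_gt0 ?enorm_gt0//; apply: le_trans (fM _ _ Ex Ey) _.
by rewrite ler_wpM2l// extended_le_enorm.
Qed.

Lemma local_modulus_bound (E : set 'rV[R]_n) (f : 'rV[R]_n -> V)
    (P : 'rV[R]_n -> 'rV[R]_n -> Prop) eta : 0 < eta ->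
  (forall x y, E x -> E y -> x <> y -> P x y ->
    `|f x - f y| <= eta / N * w (enorm (x - y))) ->
  forall x y, E x -> E y -> P x y -> `|f x - f y| <= eta * extended `|x - y|.
Proof.
move=> eta0 fP x y Ex Ey Pxy; have [e_ge0 _ _] := extended_modulus.
have N0 : 0 < N by rewrite mulr_gt0.
have [->|/eqP xy] := eqVneq x y; first by rewrite subrr normr0 mulr_ge0// ltW.
apply: le_trans (fP _ _ Ex Ey xy Pxy) _; rewrite -mulrA ler_wpM2l ?(ltW eta0)//.
by rewrite ler_pdivrMl// extended_enorm_le.
Qed.
End ExtendedModulus.

(** * Both statements deduced from the sup-norm approximations *)

Theorem corollary1p9 (R : realType) (n : nat) (w : R -> R)
  (w_pos : forall t : R, 0 < t -> 0 < w t)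
  (w_nondecreasing : forall s t : R, 0 < s -> s <= t -> w s <= w t)
  (w_lim0 : w t @[t --> 0^'+] --> 0)
  (w_ratio_lim0 : t / w t @[t --> 0^'+] --> 0)
  (w_limoo : w t @[t --> +oo] --> +oo)
  (w_ratio : exists2 Cw : R, 0 < Cw &
     forall s t : R, 0 < s -> s <= t -> s / w s <= Cw * (t / w t)) :
  exists2 C : R, 0 < C &
  forall (E : set 'rV[R]_n) (V : completeNormedModType R), closed E ->
    (forall (f : 'rV[R]_n -> V) (eps : R), VC_small w E f -> 0 < eps ->
      exists G : 'rV[R]_n -> V,
        [/\ Lip G, Cinfty G, holder w setT G,
            (holder_seminorm w E (fun x => (f x - G x)%R) < eps%:E)%E &
            (holder_seminorm w setT G <= C%:E * holder_seminorm w E f)%E]) /\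
    (forall (f : 'rV[R]_n -> V) (eps : R), VC w E f -> 0 < eps ->
      exists G : 'rV[R]_n -> V,
        [/\ Cc_infty G, holder w setT G,
            (holder_seminorm w E (fun x => (f x - G x)%R) < eps%:E)%E &
            (holder_seminorm w setT G <= C%:E * holder_seminorm w E f)%E]).
Proof.
have [Cw Cw0 wr] := w_ratio.
have [K1 K10 approx1] := @approx_small_scale R n Cw Cw0.
have [K2 K20 approx2] := @approx_compact_support R n Cw Cw0.
pose N : R := Cw * n.+1%:R; have N0 : 0 < N by rewrite mulr_gt0.
pose we := extended w.
have weC : modulus we Cw by exact: extended_modulus.
have KN0 : 0 < (K1 + K2) * N by rewrite mulr_gt0// addr_gt0.
exists ((K1 + K2) * N) => // E V _.
(* The lattice construction needs a point of E; for empty E the zero function does. *)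
have [->|/set0P E0] := eqVneq E set0.
  have zero (f : 'rV[R]_n -> V) eps : 0 < eps ->
      [/\ holder w setT (fun _ : 'rV[R]_n => 0%R : V),
       (holder_seminorm w set0 (fun x => (f x - 0)%R) < eps%:E)%E &
       (holder_seminorm w setT (fun _ : 'rV[R]_n => 0%R : V) <=
          ((K1 + K2) * N)%:E * holder_seminorm w set0 f)%E].
    move=> eps0.
    have G0 : (holder_seminorm w setT (fun _ : 'rV[R]_n => 0%R : V) <= 0%:E)%E.
      apply/(osc_supP w_pos); split=> // x y _ _ xy _.
      by rewrite subrr normr0 mul0r.
    split; first exact: le_lt_trans G0 (ltry _).
      by rewrite /holder_seminorm osc_sup_set0// lte_fin.
    by rewrite [X in (_ * X)%E]osc_sup_set0// mule0.
  split=> f eps _ eps0; have [z1 z2 z3] := zero f eps eps0; exists (fun=> 0);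
    split=> //.
  - by exists 0 => x y; rewrite subrr normr0 mul0r.
  - by move=> k; exact: Ck_cst.
  - split; first by move=> k; exact: Ck_cst.
    by apply: (@compact_supp_le _ _ _ _ 0).
have finM (f : 'rV[R]_n -> V) : holder w E f -> exists2 M, 0 <= M &
    holder_seminorm w E f = M%:E /\ modulus_bound we (M * N) E f.
  move=> fw; have f0 : (0 <= holder_seminorm w E f)%E by exact: osc_sup_ge0.
  have fin : holder_seminorm w E f \is a fin_num by rewrite ge0_fin_numE.
  exists (fine (holder_seminorm w E f)); first exact: fine_ge0.
  split; first by rewrite fineK.
  have : (holder_seminorm w E f
    <= (fine (holder_seminorm w E f))%:E)%E by rewrite fineK.
  move=> /(osc_supP w_pos)[M0 fM];
    apply: (enorm_modulus_bound w_pos w_nondecreasing wr Cw0) => // x y Ex Ey xy.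
  exact: fM.
(* The choice of eta gives K * eta = eps / 2, hence the strict inequality, and K1 + K2 covers both
   constructions. *)
have conclude (f G : 'rV[R]_n -> V) M K eta eps : 0 <= M -> 0 < K -> K <= K1 + K2 ->
    0 < eps -> eta = eps / (2 * K) ->
    holder_seminorm w E f = M%:E ->
    modulus_bound we (K * (M * N)) setT G ->
    modulus_bound we (K * eta) E (fun x => f x - G x) ->
    [/\ holder w setT G, (holder_seminorm w E (fun x => (f x - G x)%R) < eps%:E)%E &
      (holder_seminorm w setT G <= ((K1 + K2) * N)%:E * holder_seminorm w E f)%E].
  move=> M0 K0 KK eps0 etaE fM GM fGM.
  have GS : (holder_seminorm w setT G <= (K * (M * N))%:E)%E.
    by apply: (modulus_bound_seminorm w_pos w_nondecreasing wr) => //;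
      rewrite !mulr_ge0// ltW.
  split; first exact: le_lt_trans GS (ltry _).
  - apply: (@le_lt_trans _ _ (K * eta)%:E).
      apply: (modulus_bound_seminorm w_pos w_nondecreasing wr) => //.
      by rewrite etaE ltW// mulr_gt0// divr_gt0// mulr_gt0.
    have -> : K * eta = eps / 2 by rewrite etaE; field; rewrite gt_eqF.
    by rewrite lte_fin; lra.
  - apply: le_trans GS _; rewrite fM -EFinM lee_fin.
    rewrite [leLHS](_ : _ = K * (N * M)); last by ring.
    rewrite -[leRHS]mulrA; apply: ler_wpM2r => //; rewrite mulr_ge0//; exact: ltW.
have small (f : 'rV[R]_n -> V) eta : 0 < eta -> VC_small w E f ->
    exists2 d, 0 < d & forall x y, E x -> E y -> `|x - y| <= d ->
      `|f x - f y| <= eta * we `|x - y|.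
  move=> eta0 [_ f0].
  have [d d0 fd] := osc_sup_cvg0 w_pos _ f0 (nbhs_right_gt 0) (divr_gt0 eta0 N0).
  (* Sup distance at most d / (n + 1) forces Euclidean distance at most d. *)
  exists (d / n.+1%:R); first by rewrite divr_gt0.
  apply: (local_modulus_bound w_pos w_nondecreasing wr Cw0 (E := E))
    => // x y Ex Ey xy xyd; apply: fd => //.
  by apply: le_trans (enorm_le_norm _) _; rewrite mulrC -ler_pdivlMr.
split=> f eps.
  move=> VCf eps0; have [fw _] := VCf; have [M M0 [fM fN]] := finM _ fw.
  pose eta := eps / (2 * K1).
  have eta0 : 0 < eta by rewrite divr_gt0// mulr_gt0.
  have [d d0 fd] := small f eta eta0 VCf.
  have MN0 : 0 <= M * N by rewrite mulr_ge0// ltW.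
  have [G [CG [L GL] GM EG]] := approx1 we V E f _ _ _ weC E0 MN0 fN eta0 d0 fd.
  have [|g1 g2 g3] := conclude f G M K1 eta eps M0 K10 _ eps0 erefl fM GM EG.
    by rewrite lerDl ltW.
  exists G; split=> //; exists `|L| => x y; apply: le_trans (GL _ _) _.
  apply: (@le_trans _ _ (`|L| * `|x - y|)); first by rewrite ler_wpM2r// ler_norm.
  by rewrite ler_wpM2l// norm_le_enorm.
move=> [VCs [_ fl] [_ ff]] eps0; have [fw _] := VCs;
  have [M M0 [fM fN]] := finM _ fw.
pose eta := eps / (2 * K2).
have eta0 : 0 < eta by rewrite divr_gt0// mulr_gt0.
have fd := small f eta eta0 VCs.
have MN0 : 0 <= M * N by rewrite mulr_ge0// ltW.
have fL : exists D, forall x y, E x -> E y -> D <= `|x - y| ->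
    `|f x - f y| <= eta * we `|x - y|.
  have [D _ fD] := osc_sup_cvg0 w_pos _ fl filterT (divr_gt0 eta0 N0).
  exists D; apply: (local_modulus_bound w_pos w_nondecreasing wr Cw0 (E := E))
    => // x y Ex Ey xy xyD; apply: fD => //.
  exact: le_trans xyD (norm_le_enorm _).
have fF : exists D, forall x y, E x -> E y -> D <= `|x| -> D <= `|y| ->
    `|f x - f y| <= eta * we `|x - y|.
  have [D _ fD] := osc_sup_cvg0 w_pos _ ff filterT (divr_gt0 eta0 N0).
  exists D => x y Ex Ey xD yD.
  apply: (local_modulus_bound w_pos w_nondecreasing wr Cw0 (E := E)
    (P := fun x y => D <= `|x| /\ D <= `|y|)) => //.
  move=> x' y' Ex' Ey' xy' [xD' yD']; apply: fD => //.
  rewrite le_min; apply/andP; split; first exact: le_trans xD' (norm_le_enorm _).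
  exact: le_trans yD' (norm_le_enorm _).
have woo A : exists T, forall t, T <= t -> A <= we t.
  have [T [_ wT]] := (cvgryPge w).1 w_limoo A.
  (* The maximum with 1 makes t positive, where [we] agrees with w; T + 1 provides the strict
     inequality T < t. *)
  exists (Num.max 1 (T + 1)) => t; rewrite ge_max => /andP[t1 tT].
  rewrite /we extended_gt0 ?(lt_le_trans ltr01)//; apply: wT.
  by rewrite (lt_le_trans _ tT)// ltrDl.
have [G [CG GM EG]] := approx2 we V E f _ _ weC woo E0 MN0 fN eta0 fd fL fF.
have [|g1 g2 g3] := conclude f G M K2 eta eps M0 K20 _ eps0 erefl fM GM EG.
  by rewrite lerDr ltW.
by exists G.
Qed.
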